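(* Let $l \ge 3$ and $k \ge 1$ be integers, and define \[ f(l,k) = \begin{cases} 6kl + 10k\log_2 k + 40k + 10k\log_2\log_2 k & \text{if } k \ge 2,\\ 0 & \text{if } k = 1.\end{cases} \] Then every finite graph $G$ either contains $k$ pairwise vertex-disjoint cycles each of length at least $l$, or contains a set $X \subseteq V(G)$ with $|X| \le f(l,k)$ such that the graph $G - X$ contains no cycle of length at least $l$.
   Context: Graphs are finite and simple. $G - X$ denotes the graph obtained from $G$ by deleting the vertices in $X$ (and all incident edges). The length of a cycle is its number of edges (equivalently, vertices). *)

(* Defs.v *)
From mathcomp Require Import all_boot.
From Stdlib Require Import Reals.
Set Implicit Arguments. Unset Strict Implicit. Unset Printing Implicit Defensive.

Definition simple_graph (T : finType) (e : rel T) : Prop :=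
  symmetric e /\ irreflexive e.

(* A cycle of length at least l in the graph (T, e), given by its cyclic
   sequence of pairwise distinct vertices s (consecutive vertices, including
   last-first, adjacent).  With l >= 3 this is exactly a graph cycle. *)
Definition long_cycle (T : finType) (e : rel T) (l : nat) (s : seq T) : Prop :=
  [/\ uniq s, cycle e s & l <= size s].

Definition long_cycle_avoiding (T : finType) (e : rel T) (l : nat)
  (X : {set T}) (s : seq T) : Prop :=
  long_cycle e l s /\ [disjoint s & X].

Definition log2 (x : R) : R := (ln x / ln 2)%R.

Definition fbound (l k : nat) : R :=
  if (2 <= k)%N then
    (6 * INR k * INR l + 10 * INR k * log2 (INR k) + 40 * INR k
     + 10 * INR k * log2 (log2 (INR k)))%R
  else 0%R.

(* Main.v *)
(* By induction on k we may delete a long cycle of length at most 6l, so assume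
   that every long cycle is longer than 6l.  Among the subgraphs with all degrees
   2 or 3 and all cycles long, let H maximize the number of branch (degree-3)
   vertices, then the number of edges.  By Simonovits' argument, H has k disjoint
   cycles unless it has few branch vertices.  By maximality, an H-path P avoiding
   the branch vertices closes to a short cycle with some path of H.

   Call a block a maximal 2-connected subgraph of G without long cycle; the gap
   between l and 6l implies that a block contains every short cycle with which it
   shares an edge.  The hitting set consists of the branch vertices, of one vertex
   at which the block changes on each degree-2 component of H where there is one,
   and of the vertices v for which some long cycle meets H in v only; distinct v
   have disjoint such cycles.  A long cycle C avoiding this set meets H at least
   twice.  If the block changed along C at a vertex y, replacing the pieces of C
   off H by paths of H would give a cycle of H through y that avoids the chosen
   vertex of its degree-2 component, which is absurd; so C lies in one block, a
   contradiction.  *)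

(* A long cycle C need not follow H, so hitting the branch vertices alone is not enough. Each piece
   of C off H closes to a short cycle with H; the obstacle is that many short cycles might chain up
   to a long one. The gap rules this out: attaching an ear of fewer than l edges to a graph without
   long cycles cannot jump from lengths below l to lengths above 6l. One chosen vertex per degree-2
   component is enough because a cycle of H that enters such a component runs through all of it.

   The second criterion in the choice of H makes every long cycle meet H: a disjoint one could be
   added as a further component.

   Constants: let b be the number of branch vertices. A degree-2 component either takes two of the
   3b darts into branch vertices or is itself a long cycle, so at most 3b/2 + k - 1 vertices are
   chosen, and at most k - 1 vertices come from cycles meeting H once. This gives 5b/2 + 2(k - 1) in
   all. Since b is at most about 4k(log k + log log k) up to a linear term, the factors 10 arise.
   The term 6kl pays for the deleted cycles. *)
Require Import Defs.
From mathcomp Require Import all_boot zify boolp.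
Set Implicit Arguments. Unset Strict Implicit. Unset Printing Implicit Defensive.

(** * Paths, cycles and ears in sets of darts *)

Section Darts.
Variable T : finType.
Implicit Types (g h b : {set T * T}) (x y z u v a : T) (p q s c : seq T).

(* A graph is a symmetric irreflexive set of darts (ordered edges); isolated vertices are ignored. *)
Definition dsym h := forall x y, (x, y) \in h -> (y, x) \in h.
Definition dirr h := forall x, (x, x) \notin h.
Definition drel h : rel T := fun x y => (x, y) \in h.
Definition nbrs h x := [set y | (x, y) \in h].
Definition deg h x := #|nbrs h x|.
Definition verts h := [set x | 0 < deg h x].
Definition darts (A : {set T}) h := [set d in h | (d.1 \in A) && (d.2 \in A)].

Fixpoint pdarts x p : {set T * T} :=
  if p is y :: p' then (x, y) |: ((y, x) |: pdarts y p') else set0.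

Lemma dsymE h : dsym h -> forall x y, ((x, y) \in h) = ((y, x) \in h).
Proof. by move=> hs x y; apply/idP/idP; apply: hs. Qed.

Lemma vertsP h x : reflect (exists y, (x, y) \in h) (x \in verts h).
Proof.
rewrite inE /deg card_gt0; apply: (iffP (set0Pn _)) => -[y]; first by rewrite inE; exists y.
by move=> xy; exists y; rewrite inE.
Qed.

Lemma vertsl h x y : (x, y) \in h -> x \in verts h.
Proof. by move=> xy; apply/vertsP; exists y. Qed.

Lemma vertsr h x y : dsym h -> (x, y) \in h -> y \in verts h.
Proof. by move=> hs /hs; apply: vertsl. Qed.

Lemma drel_sub h g : h \subset g -> subrel (drel h) (drel g).
Proof. by move=> /subsetP hg x y; apply: hg. Qed.

Lemma path_subset h g x p : h \subset g -> path (drel h) x p -> path (drel g) x p.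
Proof. by move=> hg; apply: sub_path; apply: drel_sub. Qed.

Lemma cycle_subset h g c : h \subset g -> cycle (drel h) c -> cycle (drel g) c.
Proof. by move=> hg; apply: sub_cycle; apply: drel_sub. Qed.

Lemma pdarts_sym x p : dsym (pdarts x p).
Proof.
elim: p x => [|y p IHp] x u v /=; first by rewrite inE.
rewrite !inE !xpair_eqE => /or3P[/andP[/eqP-> /eqP->]|/andP[/eqP-> /eqP->]|/IHp ->];
  by rewrite ?eqxx ?orbT.
Qed.

Lemma path_pdarts x p : path (drel (pdarts x p)) x p.
Proof.
elim: p x => [|y p IHp] x //=; rewrite {1}/drel !inE eqxx /=.
by apply: path_subset (IHp y); apply/subsetP => d dp; rewrite !inE dp !orbT.
Qed.

Lemma pdarts_subset h x p : dsym h -> (pdarts x p \subset h) = path (drel h) x p.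
Proof.
move=> hs; elim: p x => [|y p IHp] x /=; first by rewrite sub0set.
rewrite !subUset !sub1set IHp /drel (dsymE hs y x) andbA andbb //.
Qed.

Lemma mem_pdarts x p u v : (u, v) \in pdarts x p -> (u \in x :: p) && (v \in x :: p).
Proof.
elim: p x => [|y p IHp] x /=; first by rewrite inE.
rewrite !inE !xpair_eqE => /or3P[/andP[/eqP-> /eqP->]|/andP[/eqP-> /eqP->]|/IHp];
  rewrite ?eqxx ?orbT // !inE => /andP[/orP[]-> /orP[]->]; by rewrite ?orbT.
Qed.

Lemma pdarts_cat x p q : pdarts x (p ++ q) = pdarts x p :|: pdarts (last x p) q.
Proof. by elim: p x => [|y p IHp] x /=; rewrite ?set0U // IHp !setUA. Qed.

Lemma pdarts_rcons x p y : pdarts x (rcons p y) = pdarts x p :|: [set (last x p, y); (y, last x p)].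
Proof. by rewrite -cats1 pdarts_cat /= setU0. Qed.

Lemma pdarts_rev x p : pdarts (last x p) (rev (belast x p)) = pdarts x p.
Proof.
elim: p x => [|y p IHp] x //=.
rewrite rev_cons pdarts_rcons IHp.
have -> : last (last y p) (rev (belast y p)) = y.
  by case: p {IHp} => //= z p; rewrite rev_cons last_rcons.
by rewrite setUC -setUA [[set (x, y)] :|: _]setUCA.
Qed.

Lemma path_rev h x q y : dsym h ->
  path (drel h) x (rcons q y) = path (drel h) y (rcons (rev q) x).
Proof.
move=> hs; rewrite -!pdarts_subset //.
by rewrite -(pdarts_rev x (rcons q y)) last_rcons belast_rcons rev_cons.
Qed.

Lemma uniq_rcons_rev x q y : uniq (x :: rcons q y) = uniq (y :: rcons (rev q) x).
Proof. by rewrite -rev_uniq rev_cons rev_rcons /=. Qed.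

Lemma path_verts h x p : dsym h -> path (drel h) x p -> {subset p <= verts h}.
Proof.
move=> hs; elim: p x => [|y p IHp] x //= /andP[xy /IHp sp] z.
by rewrite inE => /orP[/eqP-> |/sp//]; apply: vertsr xy.
Qed.

Lemma path_verts1 h x p : path (drel h) x p -> p != [::] -> x \in verts h.
Proof. by case: p => // y p /= /andP[+ _] _; apply: vertsl. Qed.

Lemma cycle_verts h c : dsym h -> cycle (drel h) c -> {subset c <= verts h}.
Proof.
case: c => // x p hs /= /(path_verts hs) sp z; rewrite inE => zp.
by apply: sp; rewrite mem_rcons inE.
Qed.

(** As [c] is nonempty, [y] and [x] are the ends of a repetition-free path with at least two edges,
    so the edge between them is not on it. *)
Lemma path_drop_edge (r : rel T) x y c : c != [::] -> uniq (x :: y :: c) ->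
  path r y (rcons c x) ->
  path (fun u v => r u v && ((u, v) != (x, y)) && ((u, v) != (y, x))) y (rcons c x).
Proof.
case: c => // z c _; rewrite /= => /and3P[+ + _] /andP[ryz rz].
rewrite !inE !negb_or => /and3P[xy xz _] /andP[yz yc].
rewrite ryz !xpair_eqE (eq_sym y x) (negbTE xy) (eq_sym z x) (negbTE xz) /= andbF /=.
apply: (@sub_in_path _ (predC1 y) r) rz => [u v /= uy vy ruv|].
  by rewrite ruv !xpair_eqE (negbTE uy) (negbTE vy) andbF.
rewrite /= eq_sym yz; apply/allP => u; rewrite mem_rcons inE /= => /orP[/eqP->//|uc].
by apply: contraNneq yc => <-.
Qed.

Lemma cycle_rot_bad (r r' : rel T) c : uniq c -> 1 < size c -> cycle r c -> ~~ cycle r' c ->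
  exists i x y p, [/\ rot i c = x :: y :: p, r x y & ~~ r' x y].
Proof.
move=> Uc c1 rc nrc.
have [x xc nx] : exists2 x, x \in c & ~~ r' x (next c x).
  apply/exists_inP; apply: contraNT nrc; rewrite negb_exists_in => /forall_inP H.
  by apply: cycle_from_next => // x xc; have:= H x xc; rewrite negbK.
have [i p Ep] := rot_to xc; exists i, x; move: nx; rewrite -(next_rot i Uc) Ep.
have := congr1 size Ep; rewrite size_rot.
case: p Ep => [|y p] Ep /=; first by move=> E; rewrite E in c1.
rewrite eqxx => _ nx; exists y, p; split=> //.
by move: rc; rewrite -(rot_cycle i) Ep /= => /andP[].
Qed.

(** A rotation puts the new edge first, and the rest of the cycle is the required path, up to
    reversal. This is the ear without inner vertices. *)
Lemma cycle_new_edge h u v c : dsym h -> u != v -> uniq c -> 2 < size c ->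
  cycle (drel (h :|: [set (u, v); (v, u)])) c -> ~~ cycle (drel h) c ->
  exists q, [/\ path (drel h) v (rcons q u), uniq (v :: rcons q u) & size c = (size q).+2].
Proof.
move=> hs uv Uc c3 rc nrc.
have [i [x [y [p [Ep rxy nxy]]]]] := cycle_rot_bad Uc (ltnW c3) rc nrc.
have := rc; rewrite -(rot_cycle i) Ep => /= /andP[_ ryp].
have := congr1 size Ep; rewrite size_rot /= => Es.
have Ux : uniq [:: x, y & p] by rewrite -Ep rot_uniq.
have p0 : p != [::] by case: (p) Es => // E; rewrite E in c3.
have := path_drop_edge p0 Ux ryp => ryp'.
have {ryp'} hp : path (drel h) y (rcons p x).
  apply: sub_path ryp' => a b' /=; rewrite /drel !inE !xpair_eqE => /andP[/andP[]].
  have : [|| (x == u) && (y == v) | (x == v) && (y == u)].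
    by move: rxy; rewrite /drel !inE !xpair_eqE; rewrite /drel in nxy; rewrite (negbTE nxy).
  by case/orP=> /andP[/eqP-> /eqP->] /orP[->//|/orP[]] => ->; rewrite ?andbT ?andbF //= => _;
    rewrite ?orbT.
have Uy : uniq (y :: rcons p x) by rewrite -rcons_cons rcons_uniq.
have : [|| (x == u) && (y == v) | (x == v) && (y == u)].
  by move: rxy; rewrite /drel !inE !xpair_eqE; rewrite /drel in nxy; rewrite (negbTE nxy).
case/orP=> /andP[/eqP xu /eqP yv]; subst x y; first by exists p.
exists (rev p); split; last by rewrite size_rev.
  by rewrite -path_rev.
by have := Uy; rewrite uniq_rcons_rev.
Qed.

(* By induction on the ear, peeling off its last edge. *)
Lemma ear_cycle h u v p c : dsym h -> uniq (u :: rcons p v) ->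
  [disjoint p & verts h] -> uniq c -> 2 < size c ->
  cycle (drel (h :|: pdarts u (rcons p v))) c -> ~~ cycle (drel h) c ->
  exists q, [/\ path (drel h) v (rcons q u), uniq (u :: p ++ v :: q) &
                size c = size p + size q + 2].
Proof.
move=> hs + + Uc c3.
elim/last_ind: p v h hs => [|p z IHp] v h hs Up dp rc nrc.
  have uv : u != v by move: Up; rewrite /= inE andbT.
  have [|q [hq Uq Sq]] := cycle_new_edge hs uv Uc c3 _ nrc.
    by move: rc; rewrite /= setU0.
  exists q; split=> //; last by rewrite Sq add0n addn2.
  by move: Uq; rewrite -rcons_cons rcons_uniq.
(* The last edge of the ear joins the graph, and the ear now ends in [z], whose only neighbour in
   [h1] is [v]. *)
pose h1 := h :|: [set (z, v); (v, z)].
have h1s : dsym h1.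
  move=> x y; rewrite !inE !xpair_eqE => /or3P[/hs->//|/andP[-> ->]|/andP[-> ->]];
  by rewrite ?orbT.
have zh : z \notin verts h by rewrite (disjointFr dp) ?mem_rcons ?inE ?eqxx.
move: Up; rewrite -rcons_cons rcons_uniq => /andP[vuz].
rewrite -rcons_cons rcons_uniq => /andP[zup Uup].
have zv : z != v by apply: contraNneq vuz => ->; rewrite inE mem_rcons inE eqxx orbT.
have vup : v \notin u :: p by apply: contra vuz; rewrite !inE mem_rcons inE => /orP[->|->]//; rewrite !orbT.
have nbz y : ((z, y) \in h1) = (y == v).
  rewrite !inE !xpair_eqE eqxx (negbTE zv) /= orbF.
  by case E: ((z, y) \in h) => //; rewrite (vertsl E) in zh.
(* A cycle of [h1] misses the degree-1 vertex [z], so it is already a cycle of [h]. *)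
have ncc : ~~ cycle (drel h1) c.
  apply: contra nrc => h1c.
  have zc : z \notin c.
    apply/negP => zc; have [i p' Ep] := rot_to zc.
    have Urc : uniq (z :: p') by rewrite -Ep rot_uniq.
    have := congr1 size Ep; rewrite size_rot; move: h1c; rewrite -(rot_cycle i) Ep /=.
    case: p' Urc {Ep} => [|a [|y p']] /= Urc; try by move=> _ E; rewrite E in c3.
    rewrite rcons_path {1}/drel nbz => /and3P[/eqP av _ /andP[_]].
    rewrite {1}/drel (dsymE h1s) nbz /= => /eqP yv _.
    by move: Urc; rewrite av -yv mem_last andbF.
  apply: (@sub_in_cycle _ (predC1 z) (drel h1)) h1c.
    move=> x y; rewrite /= !inE => xz yz; rewrite /drel !inE !xpair_eqE (negbTE xz) (negbTE yz).
    by rewrite andbF !orbF.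
  by apply/allP => x xc /=; apply: contraNneq zc => <-.
have [q1 [h1q Uq1 Sq1]] : exists q, [/\ path (drel h1) z (rcons q u), uniq (u :: p ++ z :: q) &
                size c = size p + size q + 2].
  apply: IHp => //.
  - by rewrite -rcons_cons rcons_uniq zup.
  - rewrite disjoint_has; apply/hasPn => x xp; apply/negP => /vertsP[y].
    have xup: x \in u :: p by rewrite inE xp orbT.
    have xv: x != v by apply: contraNneq vup => <-.
    have xz: x != z by apply: contraNneq zup => <-.
    rewrite !inE !xpair_eqE (negbTE xv) (negbTE xz) !orbF => xy.
    by have := disjointFr dp (_ : x \in _); rewrite mem_rcons inE xp orbT (vertsl xy) => /(_ isT).
  - move: rc; congr (cycle (drel _) c); rewrite pdarts_rcons last_rcons -setUA.
    by congr (_ :|: _); rewrite setUC.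
have zu : z != u by apply: contraNneq zup => ->; rewrite inE eqxx.
have := h1q; case: q1 h1q Uq1 Sq1 => [|y q] h1q Uq1 Sq1 /=; rewrite /drel nbz.
  move=> /andP[/eqP E _]; by rewrite E inE eqxx in vup.
move=> /andP[/eqP E vq]; subst y.
have {Uq1} : uniq (u :: rcons p z ++ v :: q) by rewrite cat_rcons.
move=> Uq; exists q; split=> //; last by rewrite Sq1 size_rcons addSnnS.
apply: (@sub_in_path _ (predC1 z) (drel h1)) vq.
  move=> x y; rewrite /= !inE => xz yz; rewrite /drel !inE !xpair_eqE (negbTE xz) (negbTE yz).
  by rewrite andbF !orbF.
rewrite /= eq_sym zv; apply/allP => x; rewrite mem_rcons inE => /orP[/eqP->|xq] /=.
  by rewrite eq_sym.
have : uniq (rcons p z ++ v :: q) by case/andP: Uq.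
rewrite cat_uniq => /and3P[_ /hasPn H _].
apply/negP => /eqP xz; have := H x; rewrite inE xq orbT xz => /(_ isT).
by rewrite mem_rcons inE eqxx.
Qed.

End Darts.

(** * Cutting sequences at marked vertices *)

Section Seqs.
Variable T : finType.
Implicit Types (x y : T) (p s t : seq T).

Lemma path_split (r : rel T) x s y t :
  path r x (s ++ y :: t) = path r x (rcons s y) && path r y t.
Proof. by rewrite -cat_rcons cat_path last_rcons. Qed.

Lemma sorted_split (r : rel T) s y t :
  sorted r (s ++ y :: t) = sorted r (rcons s y) && path r y t.
Proof. by case: s => [|x s] //=; rewrite path_split. Qed.

(** Induction over the visits of a path to [A]: one step covers a whole segment whose interior [s]
    avoids [A]. It serves to replace such segments one by one. *)
Lemma seg_elim (A : pred T) (P : T -> seq T -> Prop) :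
  (forall x, P x [::]) ->
  (forall x s y t, A x -> A y -> ~~ has A s -> P y t -> P x (s ++ y :: t)) ->
  forall x p, A x -> A (last x p) -> P x p.
Proof.
move=> P0 PS x p; have [n] := ubnP (size p); elim: n x p => // n IHn x p + Ax Al.
case: (boolP (has A p)) => [|nA].
  move=> hA; move: Al; case/split_find: hA => y s t Ay nAs.
  rewrite cat_rcons last_cat size_cat /= => Al; rewrite ltnS => szn; apply: PS => //.
  by apply: IHn => //; apply: leq_trans szn; rewrite addnS ltnS leq_addl.
case: p nA Al => [|y p] nA Al; first by move=> _; apply: P0.
by have /hasPn/(_ _ (mem_last y p)) := nA; rewrite Al.
Qed.

Lemma uniq_cat_disj s t : uniq (s ++ t) -> forall x, x \in s -> x \notin t.
Proof. by rewrite cat_uniq => /and3P[_ /hasPn H _] x xs; apply/negP => /H; rewrite /= xs. Qed.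

Lemma split_index2 s x y : uniq s -> x \in s -> y \in s -> index x s < index y s ->
  exists s1 m s3, s = s1 ++ x :: m ++ y :: s3 /\ index y s = (index x s + size m).+1.
Proof.
move=> Us xs; case/splitPr: xs Us => s1 s2 Us.
have xs1 : x \notin s1 by apply: (contraL (uniq_cat_disj Us (x := x))); rewrite inE eqxx.
have ix : index x (s1 ++ x :: s2) = size s1 by rewrite index_cat (negbTE xs1) /= eqxx addn0.
rewrite ix mem_cat index_cat; case: ifP => [ys1 _|ys1 /=].
  by have := index_mem y s1; rewrite ys1; lia.
rewrite inE (eq_sym x); case: eqVneq => [->|_ /= ys2 _]; first by rewrite addn0 ltnn.
case/splitPr: ys2 Us {ix} => m s3 Us; exists s1, m, s3; split=> //.
have ym : y \notin m.
  move: Us; rewrite cat_uniq => /and3P[_ _ /= /andP[_]] /uniq_cat_disj H.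
  by apply: (contraL (H y)); rewrite inE eqxx.
by rewrite index_cat (negbTE ym) /= eqxx addn0 addnS.
Qed.

End Seqs.

(** * Two-connectedness and short blocks *)

Section Blocks.
Variable T : finType.
Implicit Types (g h b : {set T * T}) (x y z u v a : T) (p q s c : seq T).

Definition rmv h v := [set d in h | (d.1 != v) && (d.2 != v)].

Definition twoconn h :=
  {in verts h &, forall x y, connect (drel h) x y} /\
  (forall v, {in verts h &, forall x y, x != v -> y != v -> connect (drel (rmv h v)) x y}).

Lemma drel_sym h : dsym h -> symmetric (drel h).
Proof. by move=> hs x y; rewrite /drel (dsymE hs). Qed.

Lemma rmv_sym h v : dsym h -> dsym (rmv h v).
Proof. by move=> hs x y; rewrite !inE /= => /and3P[/hs -> -> ->]. Qed.

Lemma rmv_sub h v : rmv h v \subset h.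
Proof. by apply/subsetP => d; rewrite inE => /andP[]. Qed.

Lemma connect_subset h g x y : h \subset g -> connect (drel h) x y -> connect (drel g) x y.
Proof. by move=> hg; apply: connect_sub => u v uv; apply: connect1; apply: drel_sub uv. Qed.

Lemma rmvS h g v : h \subset g -> rmv h v \subset rmv g v.
Proof. by move=> /subsetP hg; apply/subsetP => d; rewrite !inE => /andP[/hg-> ->]. Qed.

Lemma path_rmv h v x p : path (drel h) x p -> v \notin x :: p -> path (drel (rmv h v)) x p.
Proof.
elim: p x => //= y p IHp x /andP[xy yp]; rewrite !inE !negb_or => /and3P[vx vy vp].
by rewrite IHp ?inE ?negb_or ?vy // /drel !inE /= (eq_sym x) (eq_sym y) vx vy !andbT.
Qed.

Lemma path_rmv_notin h v x p : path (drel (rmv h v)) x p -> v != x -> v \notin x :: p.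
Proof.
elim: p x => [|y p IHp] x /=; first by rewrite mem_seq1.
rewrite {1}/drel inE /= => /andP[/and3P[_ _ yv] /IHp H] vx.
by rewrite inE negb_or vx; apply: H; rewrite eq_sym.
Qed.

Lemma path_connect_last (r : rel T) x p : path r x p -> connect r x (last x p).
Proof. by move=> rp; apply/connectP; exists p. Qed.

Lemma connect_uniq (r : rel T) x y : connect r x y ->
  exists p, [/\ path r x p, uniq (x :: p) & last x p = y].
Proof. by case/connectP => p rp ->; case/shortenP: rp => p' rp' Up _; exists p'. Qed.

Lemma cycle_rev h c : dsym h -> cycle (drel h) (rev c) = cycle (drel h) c.
Proof. by move=> hs; rewrite rev_cycle; apply: eq_cycle => x y; rewrite drel_sym. Qed.

(* Whitney's theorem. The graph K2 counts as 2-connected here, whence the first alternative. *)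
Lemma twoconn_cycle h : dsym h -> dirr h -> twoconn h -> {in verts h &, forall x y, x != y ->
  (x, y) \in h \/ exists c, [/\ long_cycle (drel h) 3 c, x \in c & y \in c]}.
Proof.
move=> hs hi [hc h2] a b0 av b0v ab.
(* [S] holds at [a] and is passed along every edge, hence along a path from [a] to [b0]. *)
pose S y := [\/ y = a, (a, y) \in h | exists c, [/\ long_cycle (drel h) 3 c, a \in c & y \in c]].
suff: S b0 by case=> [E||]; [rewrite E eqxx in ab | left | right].
have step x y : S x -> (x, y) \in h -> S y.
  move=> Sx xy; have [->|ya] := eqVneq y a; first by constructor 1.
  have [xa|xa] := eqVneq x a; first by rewrite xa in xy; constructor 2.
  have xny : x != y by apply: contraTneq xy => ->; apply: hi.
  have yv := vertsr hs xy.
  have ax : a != x by rewrite eq_sym.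
  have yx : y != x by rewrite eq_sym.
  have [q [rq Uq Lq]] := connect_uniq (h2 x y a yv av yx ax).
  have hq := path_subset (rmv_sub h x) rq.
  have xq := path_rmv_notin rq xny.
  case: Sx => [E|ax'|[c [[Uc cc c3] ac xc]]]; first by rewrite E eqxx in xa.
    constructor 3; exists (x :: y :: q).
    case: q Lq hq Uq xq {rq} => [|z q] Lq hq Uq xq; first by move: ya; rewrite -Lq eqxx.
    split; last by rewrite !inE eqxx orbT.
      split=> //; first by rewrite cons_uniq xq.
      by move: hq; rewrite (cycle_path a) /= (Lq : last z q = a) [drel h a x]ax' [drel h x y]xy.
    by rewrite -Lq inE mem_last orbT.
  case yc: (y \in c); first by constructor 3; exists c.
  have hasq : has (mem c) q.
    apply/hasP; exists a => //; have := mem_last y q; rewrite Lq inE eq_sym (negbTE ya) //.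
  (* The new cycle goes from [x] to [y], along [q] to its first contact [z] with [c], and back to
     [x] on the arc of [c] that contains [a]. *)
  have main c' : cycle (drel h) (x :: c') -> uniq (x :: c') -> (x :: c') =i c ->
      forall z q1 q2 s1 s2, q = rcons q1 z ++ q2 -> ~~ has (mem c) q1 -> c' = s1 ++ z :: s2 ->
      a \in z :: s2 -> S y.
    move=> cc' Uc' Ec z q1 q2 s1 s2 Eq nq1 Ec' a2; constructor 3.
    exists (x :: y :: q1 ++ z :: s2); split; last by rewrite !inE eqxx orbT.
    - split; last by rewrite /= size_cat /= addnS.
      + move: Uc'; rewrite Ec' cons_uniq mem_cat negb_or cat_uniq => /and3P[/andP[_ xzs] _ /andP[_ Uzs]].
        move: Uq xq; rewrite Eq cat_rcons -cat_cons mem_cat negb_or cat_uniq.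
        move=> /and3P[Uyq _ _] /andP[xyq _].
        rewrite cons_uniq -cat_cons mem_cat negb_or xzs xyq cat_uniq Uzs Uyq !andbT.
        apply/hasPn => w wzs; have wc : w \in c by rewrite -Ec Ec' inE mem_cat wzs !orbT.
        rewrite /= inE negb_or; apply/andP; split.
          by apply: contraFneq yc => <-.
        by apply: contra nq1 => wq1; apply/hasP; exists w.
      + move: cc' hq; rewrite /= Ec' Eq cat_rcons !rcons_cat !rcons_cons !path_split.
        by move=> /andP[_ ->] /andP[-> _]; rewrite !andbT.
    - by rewrite !inE mem_cat a2 !orbT.
  have [z [q1 [q2 [Eq zc nq1]]]] :
      exists z q1 q2, [/\ q = rcons q1 z ++ q2, z \in c & ~~ has (mem c) q1].
    by case/split_find: hasq => z q1 q2 zc nq1; exists z, q1, q2.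
  have [i c' Ec'] := rot_to xc.
  have zx : z != x by apply: contraNneq xq => <-; rewrite Eq !inE mem_cat mem_rcons inE eqxx !orbT.
  have Ecc : x :: c' =i c by move=> w; rewrite -Ec' mem_rot.
  have zc' : z \in c' by have := Ecc z; rewrite zc inE (negbTE zx).
  have cc' : cycle (drel h) (x :: c') by rewrite -Ec' rot_cycle.
  have Uc' : uniq (x :: c') by rewrite -Ec' rot_uniq.
  case/splitPr: zc' {Ec'} Ecc cc' Uc' => s1 s2 Ecc cc' Uc'.
  have : a \in x :: (s1 ++ z :: s2) by rewrite Ecc.
  rewrite inE (negbTE ax) /= mem_cat => /orP[as1|as2]; last first.
    exact: (main _ cc' Uc' Ecc z q1 q2 s1 s2).
  (* If [a] lies on the other arc, the cycle is traversed backwards. *)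
  have Er : rotr 1 (rev (x :: s1 ++ z :: s2)) = x :: (rev s2 ++ z :: rev s1).
    by rewrite rev_cons rotr1_rcons rev_cat rev_cons cat_rcons.
  apply: (main (rev s2 ++ z :: rev s1) _ _ _ z q1 q2 _ _ Eq nq1 erefl).
  - by rewrite -Er rotr_cycle cycle_rev.
  - by rewrite -Er rotr_uniq rev_uniq.
  - by move=> w; rewrite -Er mem_rotr mem_rev Ecc.
  - by rewrite inE mem_rev as1 orbT.
have /connectP[p hp ->] := hc a b0 av b0v.
suff H x : S x -> path (drel h) x p -> S (last x p) by apply: H => //; constructor 1.
elim: p x {hp} => [|y p IHp] x //= Sx; case/andP => xy; apply: IHp; exact: step xy.
Qed.

End Blocks.

(** * Extending blocks by short ears *)

Section BlockTheory.
Variables (T : finType) (l : nat) (E : {set T * T}).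
Hypotheses (l3 : 2 < l) (Es : dsym E) (Ei : dirr E).
Hypothesis gap : forall c, long_cycle (drel E) l c -> 6 * l < size c.
Implicit Types (g h b : {set T * T}) (x y z u v a : T) (p q s c : seq T).

(** Maximality is left out, so that blocks can be built up ear by ear; [maxblock] adds it. *)
Definition block b :=
  [/\ dsym b, b \subset E, twoconn b & forall c, ~ long_cycle (drel b) l c].

(** The two vertices are adjacent or lie on a common cycle of [b], which has fewer than [l]
    vertices; an arc of it serves. *)
Lemma block_dist b u v : block b -> u \in verts b -> v \in verts b -> u != v ->
  exists p, [/\ path (drel b) u (rcons p v), uniq (u :: rcons p v) & (size p).+1 < l].
Proof.
case=> bs bE b2 bl ub vb uv.
have bi : dirr b by move=> x; apply: contra (Ei x); apply: (subsetP bE).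
case: (twoconn_cycle bs bi b2 ub vb uv) => [buv|[c [[Uc cc c3] uc vc]]].
  by exists [::]; rewrite /= [drel _ _ _]buv inE uv; split=> //; lia.
have szc : size c < l.
  by rewrite ltnNge; apply/negP => lc; apply: (bl c); split.
have [i c' Ec] := rot_to uc.
have Uc' : uniq (u :: c') by rewrite -Ec rot_uniq.
have cc' : cycle (drel b) (u :: c') by rewrite -Ec rot_cycle.
have vc' : v \in c' by have := vc; rewrite -(mem_rot i) Ec inE eq_sym (negbTE uv).
have Sc : size c = (size c').+1 by rewrite -(size_rot i) Ec.
case/splitPr: vc' {Ec} Uc' cc' Sc => s1 s2 Uc' cc' Sc; exists s1.
move: cc'; rewrite /= rcons_cat rcons_cons path_split => /andP[-> _].
split=> //; last by move: Sc szc; rewrite size_cat /=; clear; lia.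
by move: Uc'; rewrite -cat_rcons -cat_cons cat_uniq => /andP[].
Qed.

(* Take a shortest [b]-path from [u] to [v] that closes [p] to a long cycle.  A
   chord of it inside [b] bounds a short cycle, so by the gap and by minimality
   it is no shortcut; hence the short [u]-[v] path of [b] cannot exist. *)
Lemma ear_gap b u v p q : block b -> u != v ->
  path (drel E) u (rcons p v) -> uniq (u :: rcons p v) -> [disjoint p & verts b] ->
  (size p).+1 < l -> path (drel b) u (rcons q v) -> uniq (u :: rcons q v) ->
  size p + size q + 2 < l.
Proof.
move=> hb uv Ep Up dp pl; have [bs bE b2 bl] := hb.
(* [R] lists all vertices of a [u]-[v] path of [b], ends included. Strong induction on its size
   replaces the choice of a shortest counterexample. *)
pose W R := [&& sorted (drel b) R, uniq R, head v R == u & last u R == v].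
suff main n R : size R < n -> W R -> size p + size R < l.
  move=> bq Uq; have := main (size q).+3 (u :: rcons q v).
  rewrite /= size_rcons -addnA addn2; apply; rewrite ?ltnSn //.
  by rewrite /W Uq /= bq last_rcons !eqxx.
elim: n R => // n IHn R; rewrite ltnS => Rn WR; rewrite ltnNge; apply/negP => lR.
have [bR UR hR tR] := and4P WR.
have {q} [q ER] : exists q, R = u :: rcons q v.
  case: R hR tR {bR UR Rn WR lR} => [|x R] /=; first by rewrite eq_sym (negbTE uv).
  move=> /eqP->; case/lastP: R => [|R y]; first by rewrite /= (negbTE uv).
  by rewrite last_rcons => /eqP->; exists R.
have dpq : [disjoint p & q].
  apply/pred0P => x /=; apply/negP => /andP[xp xq].
  have := disjointFr dp xp; rewrite (path_verts bs (_ : path (drel b) u (rcons q v))) //.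
    by move: bR; rewrite ER.
  by rewrite mem_rcons inE xq orbT.
have Upq : uniq (u :: p ++ v :: rev q).
  have := Up; rewrite -rcons_cons rcons_uniq => /andP[vup Uup].
  have : uniq (u :: rcons q v) by rewrite -ER.
  rewrite cons_uniq mem_rcons inE negb_or rcons_uniq => /and3P[/andP[_ uq] vq Uq].
  rewrite -cat_cons cat_uniq Uup cons_uniq mem_rev vq rev_uniq Uq !andbT.
  apply/hasPn => x; rewrite inE mem_rev => /orP[/eqP->//|xq] /=.
  rewrite inE negb_or (disjointFl dpq xq) andbT.
  by apply: contraNneq uq => <-.
have big : 6 * l < size p + size R.
  have -> : size p + size R = size (u :: p ++ v :: rev q).
    by rewrite ER /= size_rcons size_cat /= size_rev; clear; lia.
  apply: gap; split=> //; last by move: lR; rewrite ER /= size_rcons size_cat /= size_rev; clear; lia.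
  rewrite /= rcons_cat rcons_cons path_split Ep /=.
  rewrite -path_rev //; apply: path_subset bE _; by move: bR; rewrite ER.
have ub : u \in verts b.
  by move: bR; rewrite ER /= => /path_verts1; apply; case: (q).
have vb : v \in verts b.
  by apply: path_verts (_ : path (drel b) u (rcons q v)) _ _ => //; [move: bR; rewrite ER | rewrite mem_rcons inE eqxx].
have [r [br Ur rl]] := block_dist hb ub vb uv.
(* Position along [R]. By [step], a path of [b] between vertices of [R] advances it by at most one
   per edge, so the short path [r] forces [R] to be short. *)
pose f x := index x R.
have step x t : x \in R -> last x t \in R -> path (drel b) x t -> uniq (x :: t) ->
    f (last x t) <= f x + size t.
  move: x t; apply: (@seg_elim _ (mem R)) => [x _ _|x s y t Rx Ry nRs IHt]; first by rewrite addn0.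
  rewrite path_split => /andP[bxs bt] Uxsyt.
  rewrite last_cat /= size_cat /=; have := IHt bt.
  move: Uxsyt; rewrite -cat_cons cat_uniq => /and3P[Uxs nsy Uyt] /(_ Uyt) Hy.
  suff Hxy : f y <= f x + (size s).+1.
    by apply: leq_trans Hy _; rewrite addnS -addSn addnA leq_add2r.
  rewrite leqNgt; apply/negP => lt.
  have lt' : f x < f y by apply: leq_trans lt; rewrite ltnS leq_addr.
  have [R1 [M [R3 [ER' fy]]]] : exists R1 M R3 : seq T,
      R = R1 ++ x :: M ++ y :: R3 /\ f y = (f x + size M).+1 := split_index2 UR Rx Ry lt'.
  have Msz : size s < size M by move: lt; rewrite fy; clear; lia.
  have nsR z : z \in s -> z \notin R.
    by move=> zs; apply: contra nRs => zR; apply/hasP; exists z.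
  have Us : uniq s by case/andP: Uxs.
  have ysx : y \notin x :: s by have /hasPn/(_ y) := nsy; rewrite inE eqxx => /(_ isT).
  have UM : uniq (x :: M ++ y :: R3) by move: UR; rewrite ER' cat_uniq => /and3P[].
  have bR' := bR; rewrite ER' sorted_split in bR'; case/andP: bR' => bR1 bM.
  have bM' := bM; rewrite path_split in bM'; case/andP: bM' => bM1 bR3.
  (* The shortcut [s] and the stretch [M] of [R] that it bypasses form a cycle of [b], hence a short
     one. *)
  have szMs : size M + size s + 2 < l.
    rewrite ltnNge; apply/negP => lM; apply: (bl (x :: M ++ y :: rev s)); split.
    - have := UM; rewrite -cat_rcons -cat_cons cat_uniq => /and3P[UM1 _ _].
      rewrite -cat_rcons -cat_cons cat_uniq UM1 rev_uniq Us andbT.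
      apply/hasPn => z; rewrite mem_rev => /nsR; apply: contra => zM.
      by rewrite ER' mem_cat -cat_rcons -cat_cons mem_cat zM orbT.
    - by rewrite /= rcons_cat rcons_cons path_split bM1 -path_rev.
    - by rewrite /= size_cat /= size_rev; move: lM; clear; lia.
  have WR' : W (R1 ++ x :: s ++ y :: R3).
    apply/and4P; split.
    - by rewrite sorted_split bR1 path_split bxs.
    - have := UR; rewrite ER' -cat_rcons catA cat_uniq => /and3P[UxM nxy UyR].
      move: UxM; rewrite cat_uniq => /and3P[Ux _ _].
      rewrite -cat_rcons cat_uniq Ux cat_uniq UyR Us andbT !andTb.
      apply/andP; split; apply/hasPn => z.
        rewrite mem_cat => /orP[/nsR|zy].
          by apply: contra => zx; rewrite ER' -cat_rcons mem_cat zx.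
        by have /hasPn/(_ z zy) := nxy; apply: contra => /= zx; rewrite mem_cat zx.
      by move=> zy; apply/negP => /nsR; rewrite ER' mem_cat inE mem_cat zy !orbT.
    - by move: hR; rewrite ER'; case: (R1).
    - by move: tR; rewrite ER' !last_cat /= !last_cat.
  have Rsz : size R = size R1 + size M + size R3 + 2 by rewrite ER' size_cat /= size_cat /=; clear; lia.
  have R'sz : size (R1 ++ x :: s ++ y :: R3) = size R1 + size s + size R3 + 2.
    by rewrite size_cat /= size_cat /=; clear; lia.
  (* By induction the path with the shortcut closes [p] to fewer than [l] vertices, and undoing the
     shortcut adds fewer than [l]; this contradicts [big]. *)
  have := IHn _ _ WR'; rewrite R'sz; move: big Rn; rewrite Rsz; move: Msz szMs; clear; lia.
have : f (last u (rcons r v)) <= f u + size (rcons r v).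
  by apply: step => //; rewrite ?last_rcons ER ?inE ?mem_rcons ?inE eqxx ?orbT.
rewrite last_rcons size_rcons /f ER index_head /= (negbTE uv) -cats1 index_cat.
have /negbTE -> : v \notin q.
  by move: UR; rewrite ER /= rcons_uniq => /and3P[].
rewrite /= eqxx; move: big rl pl; rewrite ER /= size_rcons; clear; lia.
Qed.

Lemma setU_sym g h : dsym g -> dsym h -> dsym (g :|: h).
Proof. by move=> gs hs x y; rewrite !inE => /orP[/gs->|/hs->]; rewrite ?orbT. Qed.

Lemma verts_ear b u v p x : u \in verts b -> v \in verts b ->
  x \in verts (b :|: pdarts u (rcons p v)) -> (x \in verts b) || (x \in p).
Proof.
move=> ub vb /vertsP[y]; rewrite inE => /orP[/vertsl->//|/mem_pdarts/andP[+ _]].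
by rewrite inE mem_rcons inE => /or3P[/eqP->|/eqP->|->]; rewrite ?ub ?vb ?orbT.
Qed.

(** After deletion of [w], an inner vertex of the ear still reaches [b] along the side of the ear
    that does not contain [w]. *)
Lemma ear_twoconn b u v p : dsym b -> twoconn b -> u \in verts b -> v \in verts b ->
  u != v -> uniq (u :: rcons p v) -> [disjoint p & verts b] ->
  twoconn (b :|: pdarts u (rcons p v)).
Proof.
move=> bs [bc b2] ub vb uv Up dp; set h := _ :|: _.
have hs : dsym h by apply: setU_sym => //; apply: pdarts_sym.
have bh : b \subset h by apply: subsetUl.
have hp : path (drel h) u (rcons p v) by apply: path_subset (path_pdarts _ _); apply: subsetUr.
have sym w : connect_sym (drel (rmv h w)) by apply/sym_connect_sym/drel_sym/rmv_sym.
have symh : connect_sym (drel h) by apply/sym_connect_sym/drel_sym.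
split.
  suff H x : x \in verts h -> exists2 z, z \in verts b & connect (drel h) x z.
    move=> x y /H[zx zxb cx] /H[zy zyb cy]; apply: connect_trans cx _.
    rewrite symh in cy; apply: connect_trans cy; apply: connect_subset bh _.
    exact: bc.
  move=> /(verts_ear ub vb)/orP[xb|]; first by exists x.
  move=> xp; case/splitPr: xp hp => p1 p2; rewrite rcons_cat rcons_cons path_split => /andP[_ p2v].
  by exists v => //; have := path_connect_last p2v; rewrite last_rcons.
move=> w; suff H x : x \in verts h -> x != w ->
    exists z, [/\ z \in verts b, z != w & connect (drel (rmv h w)) x z].
  move=> x y xh yh xw yw; have [zx [zxb zxw cx]] := H x xh xw; have [zy [zyb zyw cy]] := H y yh yw.
  apply: connect_trans cx _; rewrite sym in cy; apply: connect_trans cy.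
  by apply: connect_subset (rmvS _ bh) _; apply: b2.
move=> /(verts_ear ub vb)/orP[xb xw|]; first by exists x.
move=> xp; case/splitPr: xp hp Up => p1 p2; rewrite rcons_cat rcons_cons path_split => /andP[p1x p2v].
rewrite -cat_cons -cat_rcons => Up xw.
have [wp2|wp2] := boolP (w \in rcons p2 v).
  have wp1 : w \notin u :: rcons p1 x.
    by apply: contraL wp2 => wp1; apply: (uniq_cat_disj Up).
  exists u; split=> //; first by apply: contraNneq wp1 => ->; rewrite inE eqxx.
  by rewrite sym; have := path_connect_last (path_rmv p1x wp1); rewrite last_rcons.
exists v; split=> //; first by apply: contraNneq wp2 => ->; rewrite mem_rcons inE eqxx.
have wp2' : w \notin x :: rcons p2 v by rewrite inE negb_or eq_sym xw.
by have := path_connect_last (path_rmv p2v wp2'); rewrite last_rcons.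
Qed.

(** A new cycle consists of the ear and a path of [b] ([ear_cycle]), and [ear_gap] bounds its
    length. *)
Lemma ear_block b u v p : block b -> u \in verts b -> v \in verts b -> u != v ->
  path (drel E) u (rcons p v) -> uniq (u :: rcons p v) -> [disjoint p & verts b] ->
  (size p).+1 < l -> block (b :|: pdarts u (rcons p v)).
Proof.
move=> hb ub vb uv Ep Up dp pl; have [bs bE b2 bl] := hb; split.
- by apply: setU_sym => //; apply: pdarts_sym.
- by rewrite subUset bE pdarts_subset.
- exact: ear_twoconn.
- move=> c [Uc cc lc].
  have c3 : 2 < size c by apply: leq_trans lc.
  case: (boolP (cycle (drel b) c)) => [bc|nbc]; first by apply: (bl c).
  have [q [bq Uq szc]] := ear_cycle bs Up dp Uc c3 cc nbc.
  have := ear_gap hb uv Ep Up dp pl (q := rev q).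
  rewrite -path_rev // bq -uniq_rcons_rev => /(_ isT).
  have Uvq : uniq (v :: rcons q u).
    rewrite -rcons_cons rcons_uniq; move: Uq; rewrite cons_uniq mem_cat negb_or cat_uniq.
    by move=> /and3P[/andP[_ ->] _ /andP[_ ->]].
  by rewrite Uvq size_rev => /(_ isT); rewrite -szc ltnNge lc.
Qed.

(** The part of [p] up to its first return to [b] is a short ear; once it is added, the rest starts
    and ends in the larger block. *)
Lemma block_path p b u : block b -> u \in verts b -> last u p \in verts b ->
  path (drel E) u p -> uniq (u :: p) -> size p < l ->
  exists b1, [/\ block b1, b \subset b1 & pdarts u p \subset b1].
Proof.
have [n] := ubnP (size p); elim: n p b u => // n IHn p b u + hb ub.
case: p => [|y0 p0]; first by exists b; rewrite /= sub0set.
set p := y0 :: p0 => szp lb Ep Up pl.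
have hasp : has (mem (verts b)) p.
  by apply/hasP; exists (last u p) => //; rewrite /p /= mem_last.
have [y [s [t [Ep' yb nbs]]]] :
    exists y s t, [/\ p = s ++ y :: t, y \in verts b & ~~ has (mem (verts b)) s].
  by case/split_find: hasp => y s t yb nbs; exists y, s, t; rewrite cat_rcons.
move: szp lb Ep Up pl; rewrite {}Ep' {p hasp y0 p0} => szp lb Ep Up pl.
have := Ep; rewrite path_split => /andP[Eps Ept].
have := Up; rewrite -cat_rcons -cat_cons => Up'; have := Up'; rewrite cat_uniq => /and3P[Us _ _].
have Ut : uniq (y :: t).
  by move: Up; rewrite -cat_cons cat_uniq => /and3P[].
have uy : u != y by apply: contraTneq Us => ->; rewrite /= mem_rcons inE eqxx.
have ds : [disjoint s & verts b] by rewrite disjoint_has.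
have sl : (size s).+1 < l.
  by move: pl; rewrite size_cat /=; clear; lia.
have hb1 := ear_block hb ub yb uy Eps Us ds sl.
have bb1 : b \subset b :|: pdarts u (rcons s y) by apply: subsetUl.
have vb1 x : x \in verts b -> x \in verts (b :|: pdarts u (rcons s y)).
  by move=> /vertsP[z xz]; apply/vertsP; exists z; rewrite inE xz.
have [||||||b2 [hb2 b12 tb2]] := IHn t _ y _ hb1 => //.
- by move: szp; rewrite size_cat /=; clear; lia.
- exact: vb1.
- by apply: vb1; move: lb; rewrite last_cat.
- by move: pl; rewrite size_cat /=; clear; lia.
exists b2; split=> //; first exact: subset_trans bb1 b12.
rewrite pdarts_cat last_rcons subUset tb2 andbT.
by apply: subset_trans b12; apply: subsetUr.
Qed.

Definition maxblock b := block b /\ forall b', block b' -> b \subset b' -> b' = b.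

Lemma maxblock_ex b : block b -> exists2 b1, maxblock b1 & b \subset b1.
Proof.
move=> hb; have Pb : (fun b => `[< block b >]) b by apply/asboolP.
have [b1 /maxsetP[/asboolP hb1 max1] bb1] := maxset_exists (P := fun b => `[< block b >]) Pb.
by exists b1 => //; split=> // b2 /asboolP hb2; apply: max1.
Qed.

(** Without the common edge, the short cycle is a path with fewer than [l] edges between two
    vertices of [b], so a larger block absorbs it; by maximality that block is [b]. *)
Lemma maxblock_cycle b c : maxblock b -> uniq c -> cycle (drel E) c -> 2 < size c < l ->
  forall x, x \in c -> (x, next c x) \in b -> {in c, forall y, (y, next c y) \in b}.
Proof.
move=> [hb maxb] Uc cc /andP[c3 cl] x xc xb.
have [bs _ _ _] := hb.
suff bc : cycle (drel b) c by move=> y yc; apply: (next_cycle bc).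
have [i c' Ec] := rot_to xc; rewrite -(rot_cycle i) Ec.
move: xb; rewrite -(next_rot i Uc) Ec.
have Uc' : uniq (x :: c') by rewrite -Ec rot_uniq.
have cc' : cycle (drel E) (x :: c') by rewrite -Ec rot_cycle.
have Sc : size c = (size c').+1 by rewrite -(size_rot i) Ec.
case: c' Ec Uc' cc' Sc => [|y c'] Ec Uc' cc' Sc; first by rewrite Sc in c3.
rewrite /= eqxx => xyb; rewrite [drel b x y]xyb /=.
move: cc'; rewrite /= => /andP[_ Ep].
have [||||b1 [hb1 bb1]] := @block_path (rcons c' x) b y hb _ _ Ep.
- exact: vertsr xyb.
- by rewrite last_rcons; apply: vertsl xyb.
- by rewrite -rcons_cons rcons_uniq.
- by rewrite size_rcons -ltnS -Sc; apply: leq_trans cl _.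
by rewrite (maxb _ hb1 bb1) pdarts_subset.
Qed.

Lemma maxblock_edge x y : (x, y) \in E -> exists2 b, maxblock b & (x, y) \in b.
Proof.
move=> xyE; pose b : {set T * T} := [set (x, y); (y, x)].
have vb z : z \in verts b -> (z == x) || (z == y).
  by move=> /vertsP[w]; rewrite !inE !xpair_eqE => /orP[]/andP[-> _]; rewrite ?orbT.
have bs : dsym b.
  by move=> u v; rewrite !inE !xpair_eqE => /orP[]/andP[-> ->]; rewrite ?orbT.
have bxy : drel b x y by rewrite /drel !inE eqxx.
have byx : drel b y x by apply: bs.
have hb : block b.
  split=> //.
  - by rewrite subUset !sub1set xyE Es.
  - split=> [u v /vb uxy /vb vxy|w u v /vb uxy /vb vxy].
      by case/orP: uxy => /eqP->; case/orP: vxy => /eqP->; rewrite ?connect0 ?connect1.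
    case/orP: uxy => /eqP-> xw; case/orP: vxy => /eqP-> yw; rewrite ?connect0 //;
      by apply: connect1; rewrite /drel inE /= xw yw !andbT.
  - move=> c [Uc cc lc]; have : size c <= size [:: x; y].
      apply: uniq_leq_size => // z /(cycle_verts bs cc) /vb; rewrite !inE //.
    by rewrite leqNgt (leq_trans l3 lc).
have [b1 mb1 /subsetP bb1] := maxblock_ex hb.
by exists b1 => //; apply: bb1.
Qed.

End BlockTheory.

(** * Disjoint cycles in subcubic graphs *)

Section Cubic.
Variable T : finType.
Implicit Types (g h b t : {set T * T}) (x y z u v a : T) (p q s c : seq T) (A S : {set T}).

Definition branch h := [set x | deg h x == 3].

Lemma card_darts h : #|h| = \sum_x deg h x.
Proof.
under eq_bigr => x _ do rewrite /deg -sum1_card.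
rewrite pair_big_dep /= -sum1_card; apply: eq_bigl => -[x y] /=; by rewrite inE.
Qed.

Lemma cycle_nbrs h c x : dsym h -> long_cycle (drel h) 3 c -> x \in c ->
  exists y z, [/\ y != z, y \in c, z \in c, (x, y) \in h & (x, z) \in h].
Proof.
move=> hs [Uc cc c3] xc; have [i c' Ec] := rot_to xc.
have Uc' : uniq (x :: c') by rewrite -Ec rot_uniq.
have cc' : cycle (drel h) (x :: c') by rewrite -Ec rot_cycle.
have Sc : size c = (size c').+1 by rewrite -(size_rot i) Ec.
have mc z : (z \in c) = (z \in x :: c') by rewrite -Ec mem_rot.
case: c' Ec Uc' cc' Sc mc => [|y c'] Ec Uc' cc' Sc mc; first by rewrite Sc in c3.
case/lastP: c' Ec Uc' cc' Sc mc => [|c' z] Ec Uc' cc' Sc mc; first by rewrite Sc in c3.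
exists y, z; rewrite !mc !inE !mem_rcons !inE !eqxx !orbT.
move: cc'; rewrite /= rcons_path last_rcons => /and3P[xy _ /hs zx]; split=> //.
by apply: contraTneq Uc' => ->; rewrite /= mem_rcons inE eqxx !andbF.
Qed.

(** * A cycle with few branch vertices, by growing a tree *)

Section Tree.
Variables (g : {set T * T}) (r : T).
Hypotheses (gs : dsym g) (gi : dirr g).

(** Vertex set, darts and weight of a tree in [g] rooted at [r]; the weight of [z] counts the branch
    vertices of [g] on the tree path from [r] to [z], without [r]. *)
Inductive tree : {set T} -> {set T * T} -> (T -> nat) -> Prop :=
| Tree0 : tree [set r] set0 (fun=> 0)
| TreeS A t w x y : tree A t w -> x \in A -> y \notin A -> (x, y) \in g ->
    tree (y |: A) (t :|: [set (x, y); (y, x)])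
         (fun z => if z == y then w x + (deg g y == 3) else w z).

Lemma tree_sub A t w : tree A t w ->
  [/\ t \subset g, dsym t, r \in A & forall x y, (x, y) \in t -> x \in A /\ y \in A].
Proof.
elim=> [|A' t' w' x y _ [tg ts rA tA] xA yA xy].
  by rewrite sub0set set11; split=> // x y; rewrite in_set0.
split.
- by rewrite !subUset tg !sub1set xy (gs xy).
- move=> u v; rewrite !inE !xpair_eqE => /or3P[/ts->//|/andP[-> ->]|/andP[-> ->]];
  by rewrite ?orbT.
- by rewrite inE rA orbT.
- move=> u v; rewrite !inE !xpair_eqE => /or3P[/tA[-> ->]|/andP[/eqP-> /eqP->]|/andP[/eqP-> /eqP->]];
  by rewrite ?eqxx ?xA ?orbT.
Qed.

Lemma dartsS A S t h : A \subset S -> t \subset h -> darts A t \subset darts S h.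
Proof.
move=> /subsetP AS /subsetP th; apply/subsetP => d; rewrite !inE.
by case/and3P => /th -> /AS -> /AS ->.
Qed.

(** [S] is the vertex set of the tree path from [r] to [z], which is all that has to be known of
    this path. *)
Lemma tree_chain A t w : tree A t w -> forall z, z \in A ->
  exists S, [/\ z \in S, S \subset A, #|(S :\ r) :&: branch g| <= w z &
                connect (drel (darts S t)) z r].
Proof.
elim=> [|A' t' w' x y tr IH xA yA xy] z.
  rewrite inE => /eqP->; exists [set r]; rewrite set11 subxx connect0 setDv set0I cards0.
  by split.
rewrite !inE; case: eqVneq => [-> _|zy /= zA]; last first.
  have [S [zS SA Sw cS]] := IH z zA; exists S; split=> //.
    by apply: subset_trans SA _; apply: subsetUr.
  by apply: connect_subset cS; apply: dartsS => //; apply: subsetUl.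
have [S [xS SA Sw cS]] := IH x xA; exists (y |: S); split.
- exact: setU11.
- by apply: setUS.
- have sub : ((y |: S) :\ r) :&: branch g \subset
     ((S :\ r) :&: branch g) :|: (if deg g y == 3 then [set y] else set0).
    apply/subsetP => u; rewrite !inE => /andP[/andP[-> /orP[/eqP->|->]]] uB.
      by rewrite uB set11 orbT.
    by rewrite uB.
  apply: leq_trans (subset_leq_card sub) _; apply: leq_trans (leq_card_setU _ _) _.
  by apply: leq_add => //; case: ifP; rewrite ?cards1 ?cards0.
- apply: connect_trans (_ : connect _ y x) _.
    by apply: connect1; rewrite /drel !inE xS !eqxx !orbT.
  by apply: connect_subset cS; apply: dartsS; apply: subsetUr || apply: subsetUl.
Qed.

(** The edge off the tree closes a path inside the union of the two tree paths to [r]. The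
    additional 1 stands for [r], which the weights do not count. *)
Lemma tree_cycle A t w x y : tree A t w -> x \in A -> y \in A -> (x, y) \in g ->
  (x, y) \notin t ->
  exists c, [/\ long_cycle (drel g) 3 c, #|[set z in c] :&: branch g| <= (w x + w y).+1 &
                {subset c <= A}].
Proof.
move=> tr xA yA xy nxy; have [tg ts _ tA] := tree_sub tr.
have [Sx [xS SxA Sxw cx]] := tree_chain tr xA.
have [Sy [yS SyA Syw cy]] := tree_chain tr yA.
pose S := Sx :|: Sy; have ds : dsym (darts S t).
  by move=> u v; rewrite !inE /= => /and3P[/ts-> -> ->].
have sx : darts Sx t \subset darts S t by apply: dartsS => //; apply: subsetUl.
have sy : darts Sy t \subset darts S t by apply: dartsS => //; apply: subsetUr.
have {cx} cx := connect_subset sx cx; have {cy} cy := connect_subset sy cy.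
have symS := sym_connect_sym (drel_sym ds).
have /connect_uniq[p [pp Up lp]] : connect (drel (darts S t)) y x.
  by apply: connect_trans cy _; rewrite symS.
have yx : y != x by apply: contraTneq xy => ->; apply: gi.
have cS : {subset y :: p <= S}.
  move=> z; rewrite inE => /orP[/eqP->|/(path_verts ds pp)/vertsP[z']]; first by rewrite inE yS orbT.
  by rewrite inE => /and3P[].
exists (y :: p); split.
- split=> //.
    rewrite (cycle_path y) /= lp [drel _ _ _]xy /=; apply: path_subset pp.
    by apply: subset_trans tg; apply/subsetP => d; rewrite inE => /andP[].
  case: p lp pp {Up cS} => [|z [|z' p]] //= => [E|E]; first by rewrite E eqxx in yx.
  by rewrite E andbT /drel inE => /andP[/ts]; rewrite (negbTE nxy).
- have sub : [set z in y :: p] :&: branch g \subset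
     r |: (((Sx :\ r) :&: branch g) :|: ((Sy :\ r) :&: branch g)).
    apply/subsetP => z; rewrite inE => /andP[]; rewrite inE => /cS; rewrite inE => zS gz; move: gz zS.
    by rewrite !inE => ->; rewrite !andbT; case: eqP.
  apply: leq_trans (subset_leq_card sub) _; rewrite cardsU1 -add1n.
  apply: leq_add; first by case: (r \notin _).
  by apply: leq_trans (leq_card_setU _ _) _; apply: leq_add.
- move=> z /cS; rewrite inE => /orP[]; [exact: (subsetP SxA) | exact: (subsetP SyA)].
Qed.

Lemma tree_connect A t w : tree A t w -> {in A, forall z, connect (drel g) r z}.
Proof.
elim=> [|A' t' w' x y tr IH xA yA xy] z; first by rewrite inE => /eqP->.
rewrite !inE => /orP[/eqP->|/IH//].
by apply: connect_trans (IH x xA) (connect1 _).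
Qed.

Hypothesis g23 : {in verts g, forall x, (deg g x == 2) || (deg g x == 3)}.

(* Kraft's equality: splitting a dart at a branch vertex halves its weight. *)
Lemma tree_kraft i A t w : tree A t w -> {in A, forall z, w z <= i} ->
  \sum_(z in A) deg (g :\: t) z * 2 ^ (i - w z) = deg g r * 2 ^ i.
Proof.
elim=> [_|A' t' w' x y tr IH xA yA xy wi]; first by rewrite big_set1 setD0 subn0.
have [tg ts rA tA] := tree_sub tr.
rewrite -IH => [|z zA]; last first.
  by have := wi z; rewrite !inE zA orbT => /(_ isT); case: eqVneq zA => // ->; rewrite (negbTE yA).
have xy' : x != y by apply: contraNneq yA => <-.
rewrite big_setU1 //= eqxx (bigD1 x) //= [RHS](bigD1 x) //= (negbTE xy').
rewrite addnA; congr (_ + _); last first.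
  apply: eq_bigr => z /andP[zA zx]; have zy : z != y by apply: contraNneq yA => <-.
  rewrite (negbTE zy); congr (_ * _); apply: eq_card => u.
  by rewrite !inE !xpair_eqE (negbTE zx) (negbTE zy) /= orbF.
have dx : deg (g :\: t') x = (deg (g :\: (t' :|: [set (x, y); (y, x)])) x).+1.
  rewrite /deg (cardsD1 y) !inE xy andbT; have -> : (x, y) \notin t' by apply: contra yA => /tA[].
  rewrite add1n; congr _.+1; apply: eq_card => u.
  by rewrite !inE !xpair_eqE eqxx (negbTE xy') /= orbF negb_or andbCA andbA.
have dy : deg g y = (deg (g :\: (t' :|: [set (x, y); (y, x)])) y).+1.
  rewrite /deg (cardsD1 x) !inE gs //= add1n; congr _.+1; apply: eq_card => u.
  rewrite !inE !xpair_eqE eqxx (eq_sym y) (negbTE xy') /=.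
  by case E: ((y, u) \in t') => //; have [] := tA _ _ E; rewrite (negbTE yA).
have yv : y \in verts g by apply: vertsr xy.
have := wi y; rewrite !inE eqxx => /(_ isT); have := g23 yv; rewrite dx dy.
move: (deg _ y) (deg _ x) (w' x) => dy' dx' wx {dx dy}.
case/orP => /eqP[->] /=; rewrite ?addn0 ?addn1 => lei.
  by rewrite mul1n mulSn.
rewrite mulSn; congr (_ + _).
by rewrite -[in RHS](subnSK lei) expnS.
Qed.

(** The tree grows while all weights stay at most [i]. It stops when an edge off the tree joins two
    of its vertices, or when it cannot grow and Kraft's equality forces two outgoing darts to
    meet. *)
Lemma short_cycle i : #|branch g| < deg g r * 2 ^ i ->
  exists c, [/\ long_cycle (drel g) 3 c, #|[set z in c] :&: branch g| <= 2 * i + 2 &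
                {subset c <= connect (drel g) r}].
Proof.
move=> few; suff main n A t w : tree A t w -> {in A, forall z, w z <= i} -> #|T| - #|A| < n ->
   exists c, [/\ long_cycle (drel g) 3 c, #|[set z in c] :&: branch g| <= 2 * i + 2 &
                {subset c <= connect (drel g) r}].
  by apply: (main #|T|.+1 _ _ _ Tree0) => //; rewrite ltnS leq_subr.
elim: n A t w => // n IHn A t w tr wi An.
have [tg ts rA tA] := tree_sub tr.
have [ext|next] := pselect (exists x y, [/\ x \in A, y \notin A, (x, y) \in g & w x + (deg g y == 3) <= i]).
  have [x [y [xA yA xy wy]]] := ext.
  apply: (IHn _ _ _ (TreeS tr xA yA xy)) => [z|].
    by rewrite !inE; case: eqVneq => // _; apply: wi.
  rewrite cardsU1 yA; have := max_card (mem (y |: A)); rewrite cardsU1 yA.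
  by move: An; clear; lia.
have done A' t' w' x y : tree A' t' w' -> x \in A' -> y \in A' -> (x, y) \in g ->
    (x, y) \notin t' -> w' x + w' y <= 2 * i + 1 ->
    exists c, [/\ long_cycle (drel g) 3 c, #|[set z in c] :&: branch g| <= 2 * i + 2 &
                {subset c <= connect (drel g) r}].
  move=> tr' xA yA xy nxy wxy; have [c [cc cb cA]] := tree_cycle tr' xA yA xy nxy.
  exists c; split=> //; first by apply: leq_trans cb _; rewrite addn2 ltnS -addn1.
  by move=> z /cA zA; rewrite -topredE /=; apply: tree_connect tr' _ zA.
have [non|nnon] := pselect (exists x y, [/\ x \in A, y \in A, (x, y) \in g & (x, y) \notin t]).
  have [x [y [xA yA xy nxy]]] := non; apply: (done _ _ _ x y tr) => //.
  by have := wi _ xA; have := wi _ yA; clear; lia.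
(* As growth is blocked and no edge inside [A] is off the tree, every dart of [D] leaves [A] from a
   vertex of weight [i] towards a branch vertex. Kraft's equality therefore counts [D] exactly. *)
pose D := [set d in g :\: t | d.1 \in A].
have DP d : d \in D -> [/\ d.1 \in A, d.2 \notin A, d \in g, w d.1 = i & d.2 \in branch g].
  case: d => x y; rewrite !inE /= => /andP[/andP[nxy xy] xA].
  have yA : y \notin A by apply/negP => yA; case: nnon; exists x, y.
  suff: i < w x + (deg g y == 3).
    have := wi _ xA; case: (deg g y == 3) => /=; last by clear; lia.
    by move=> wx iw; split=> //; move: wx iw; clear; lia.
  by rewrite ltnNge; apply/negP => le; case: next; exists x, y.
have cardD : #|D| = deg g r * 2 ^ i.
  rewrite -(tree_kraft tr wi) card_darts [RHS]big_mkcond /=; apply: eq_bigr => x _.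
  case: ifP => xA; last first.
    by apply: eq_card0 => y; rewrite !inE /= xA andbF.
  have <- : deg D x = deg (g :\: t) x by apply: eq_card => y; rewrite !inE /= xA andbT.
  case: (posnP (deg D x)) => [->//|]; rewrite card_gt0 => /set0Pn[y]; rewrite inE => xyD.
  by have [_ _ _ /= -> _] := DP _ xyD; rewrite subnn muln1.
have [/dinjectiveP inj|/dinjectivePn[[x y] xyD [[x' y'] /=]]] := boolP (dinjectiveb snd D).
  have := card_in_imset inj; rewrite cardD => Eim.
  have : snd @: D \subset branch g.
    by apply/subsetP => y /imsetP[d /DP[_ _ _ _ ?] ->].
  by move=> /subset_leq_card; rewrite Eim leqNgt few.
rewrite inE => /andP[nd xyD'] E; subst y'.
have [/= xA yA xy wx yb] := DP _ xyD; have [/= xA' _ xy' wx' _] := DP _ xyD'.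
(* The common end [y] joins the tree through [x] with weight [i + 1]; the second dart, from [x'] of
   weight [i], closes the cycle. *)
apply: (done _ _ _ x' y (TreeS tr xA yA xy)) => //.
- by rewrite !inE xA' orbT.
- by rewrite !inE eqxx.
- rewrite !inE !xpair_eqE negb_or; apply/andP; split.
    by apply: contra yA => /tA[].
  have x'y : x' != y by apply: contraNneq yA => <-.
  by move: nd; rewrite xpair_eqE (negbTE x'y) eqxx !andbT orbF.
- have /negbTE-> : x' != y by apply: contraNneq yA => <-.
  by rewrite eqxx wx wx'; case: (_ == _); clear; lia.
Qed.

End Tree.

Definition packing (r : rel T) l k := exists cs : seq (seq T),
  [/\ size cs = k, {in cs, forall c, long_cycle r l c} &
      pairwise (fun c d : seq T => [disjoint c & d]) cs].

Lemma deg_sub g h x : g \subset h -> deg g x <= deg h x.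
Proof.
by move=> /subsetP gh; apply: subset_leq_card; apply/subsetP => y; rewrite !inE => /gh.
Qed.

Lemma verts_sub g h : g \subset h -> verts g \subset verts h.
Proof.
by move=> gh; apply/subsetP => x; rewrite !inE => x0; apply: leq_trans x0 (deg_sub x gh).
Qed.

Lemma card_rem_edge g x y : dsym g -> dirr g -> (x, y) \in g ->
  #|g| = (#|g :\: [set (x, y); (y, x)]| + 2)%N.
Proof.
move=> gs gi xy; rewrite cardsD; have -> : g :&: [set (x, y); (y, x)] = [set (x, y); (y, x)].
  apply/setIidPr; by rewrite !subUset !sub1set xy (gs x y xy).
have xney : x != y by apply: contraTneq xy => ->; apply: gi.
rewrite cards2 xpair_eqE (negbTE xney) /= subnK //.
have <- : #|[set (x, y); (y, x)]| = 2 by rewrite cards2 xpair_eqE (negbTE xney).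
by apply: subset_leq_card; rewrite !subUset !sub1set xy (gs x y xy).
Qed.

Lemma rem_edge_sym g x y : dsym g -> dsym (g :\: [set (x, y); (y, x)]).
Proof.
move=> gs u v; rewrite !inE !xpair_eqE !negb_or => /andP[/andP[H1 H2] /gs->].
by rewrite andbT; apply/andP; split; rewrite andbC.
Qed.

Lemma sum_deg_branch g : {in verts g, forall x, (deg g x == 2) || (deg g x == 3)} ->
  forall A, \sum_(x in A) deg g x = 2 * #|A :&: verts g| + #|A :&: branch g|.
Proof.
move=> g23 A; rewrite -!sum1_card big_distrr /= !(big_mkcond (fun x => x \in _)) /= -big_split /=.
apply: eq_bigr => x _; rewrite !inE; case: (x \in A) => //=.
case: (posnP (deg g x)) => [->//|d0]; have : x \in verts g by rewrite inE.
by move=> /g23/orP[]/eqP->.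
Qed.

(** If the cycle [C] has [t] branch vertices, then [2 * #|C| + t] darts start in it and as many end
    in it, while the darts of the cycle, at least [2 * #|C|], are counted twice. *)
Lemma cycle_remove g c : dsym g -> {in verts g, forall x, (deg g x == 2) || (deg g x == 3)} ->
  long_cycle (drel g) 3 c ->
  #|g| <= #|darts (~: [set z in c]) g| + 2 * #|[set z in c]| + 2 * #|[set z in c] :&: branch g|.
Proof.
move=> gs g23 cc; set C := [set z in c]; set g2 := darts _ _; pose d1 := [set d in g | d.1 \in C]; pose d2 := [set d in g | d.2 \in C].
have Cv : C :&: verts g = C.
  apply/setIidPl/subsetP => x; rewrite inE => xc; have [_ cc' _] := cc.
  exact: cycle_verts cc' _ xc.
have card1 : #|d1| = 2 * #|C| + #|C :&: branch g|.
  rewrite card_darts -[in 2 * #|C|]Cv -sum_deg_branch // [RHS]big_mkcond; apply: eq_bigr => x _ /=.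
  by case: ifP; rewrite inE => xc; [apply: eq_card | apply: eq_card0] => y; rewrite !inE /= xc ?andbT ?andbF.
have card2 : #|d2| = #|d1|.
  have swap_inj : injective (fun d : T * T => (d.2, d.1)) by move=> [? ?] [? ?] [-> ->].
  rewrite -(card_imset _ swap_inj); apply: eq_card => -[x y]; rewrite !inE /=.
  apply/imsetP/andP => [[[u v]]|[xy yc]].
    by rewrite inE => /andP[/gs vu /=]; rewrite inE => uc [-> ->].
  by exists (y, x) => //; rewrite !inE /= (gs _ _ xy).
have both : 2 * #|C| <= #|d1 :&: d2|.
  rewrite card_darts mulnC -sum_nat_const [leqLHS]big_mkcond /=; apply: leq_sum => x _.
  case: ifP => // xC; have xc : x \in c by rewrite inE in xC.
  have [y [z [yz yc zc xy xz]]] := cycle_nbrs gs cc xc.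
  have <- : #|[set y; z]| = 2 by rewrite cards2 yz.
  apply: subset_leq_card; apply/subsetP => u.
  by rewrite !inE => /orP[]/eqP->; rewrite ?xy ?xz xc ?yc ?zc.
have sub : g \subset g2 :|: (d1 :|: d2).
  apply/subsetP => -[x y] xy; rewrite !inE /= xy /=.
  by case: (x \in c); case: (y \in c).
have := subset_leq_card sub; move/leq_trans; apply.
apply: leq_trans (leq_card_setU _ _) _; rewrite -addnA leq_add2l cardsU card2.
by rewrite leq_subLR; move: both; rewrite card1; clear; lia.
Qed.

(* Simonovits' bound, as an excess: [|g| - 2 |verts g|] is at most the number of
   branch vertices, and deleting a cycle through [t] of them lowers it by at most [2 t]. *)
Lemma excess_packing i K : K * (4 * i + 4) + 3 < 3 * 2 ^ i -> forall j g, j <= K ->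
  dsym g -> dirr g -> (forall x, deg g x <= 3) ->
  2 * #|verts g| + j * (4 * i + 4) + 2 <= #|g| -> packing (drel g) 3 j.+1.
Proof.
move=> Ki; elim/ltn_ind => j IHj g jK.
have [n] := ubnP #|g|; elim: n g => // n IHn g gn gs gi g3 ex.
(* An edge may be deleted if the excess stays large enough; the inner induction on [#|g|] then
   finishes. *)
have shrink x y : (x, y) \in g ->
    2 * #|verts (g :\: [set (x, y); (y, x)])| + j * (4 * i + 4) + 4 <= #|g| ->
    packing (drel g) 3 j.+1.
  move=> xy; rewrite (card_rem_edge gs gi xy) => ex'.
  have sub : g :\: [set (x, y); (y, x)] \subset g by apply: subsetDl.
  have [|||||cs [Scs ccs pcs]] := IHn (g :\: [set (x, y); (y, x)]).
  - by move: gn; rewrite (card_rem_edge gs gi xy); clear; lia.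
  - exact: rem_edge_sym.
  - by move=> z; rewrite inE (negbTE (gi z)) andbF.
  - by move=> z; apply: leq_trans (deg_sub z sub) (g3 z).
  - by move: ex'; clear; lia.
  exists cs; split=> // c /ccs[Uc cc lc]; split=> //; exact: cycle_subset sub cc.
have [[x x1]|n1] := pselect (exists x, deg g x == 1).
  have [y Ny] := cards1P x1; have xy : (x, y) \in g by have := set11 y; rewrite -Ny inE.
  (* At a vertex of degree 1 the deletion loses two darts and at least one vertex, so the excess
     does not drop. *)
  apply: (shrink x y xy); suff : (#|verts (g :\: [set (x, y); (y, x)])|).+1 <= #|verts g|.
    by move: ex; clear; lia.
  have xv : x \in verts g by apply: vertsl xy.
  rewrite [X in _ <= X](cardsD1 x) xv add1n ltnS; apply: subset_leq_card.
  rewrite subsetD1 verts_sub ?subsetDl //=; apply/vertsP => -[z].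
  rewrite !inE !xpair_eqE eqxx negb_or /= => /andP[/andP[zy _] xz].
  have : z \in nbrs g x by rewrite inE.
  by rewrite Ny inE (negbTE zy).
have g23 : {in verts g, forall x, (deg g x == 2) || (deg g x == 3)}.
  move=> x; rewrite inE => x0; have := g3 x; have : deg g x != 1 by apply/negP => ?; apply: n1; exists x.
  by move: x0; case: (deg g x) => [|[|[|[|]]]].
have Eg : #|g| = 2 * #|verts g| + #|branch g|.
  by rewrite card_darts -[verts g]setTI -[branch g]setTI -sum_deg_branch //; apply: eq_bigl => x; rewrite inE.
(* The excess now equals the number of branch vertices. If it has two to spare, any edge can go;
   otherwise it is below [3 * 2 ^ i] and [short_cycle] applies at a branch vertex. *)
have [big|small] := leqP (j * (4 * i + 4) + 4) #|branch g|.
  have /card_gt0P[[x y] xy] : 0 < #|g| by move: ex; clear; lia.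
  apply: (shrink x y xy).
  have := subset_leq_card (verts_sub (subsetDl g [set (x, y); (y, x)])).
  by move: big; rewrite Eg; clear; lia.
have /card_gt0P[r rb] : 0 < #|branch g| by move: ex; rewrite Eg; clear; lia.
have dr : deg g r = 3 by move: rb; rewrite inE => /eqP.
have jKi : j * (4 * i + 4) <= K * (4 * i + 4) by apply: leq_mul.
have few : #|branch g| < deg g r * 2 ^ i.
  by rewrite dr; apply: leq_trans Ki; move: small jKi; clear; lia.
have [c [cc cb _]] := short_cycle gs gi g23 few.
case: j IHj jK ex shrink IHn small jKi => [|j] IHj jK ex _ _ small jKi.
  by exists [:: c]; split=> // c'; rewrite inE => /eqP->.
set C := [set z in c] in cb; pose g2 := darts (~: C) g.
have sub : g2 \subset g by apply/subsetP => d; rewrite inE => /andP[].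
have g2s : dsym g2 by move=> x y; rewrite !inE /= => /andP[/gs-> /andP[-> ->]].
have v2 : #|verts g2| + #|C| <= #|verts g|.
  have dis : [disjoint verts g2 & C].
    apply/pred0P => x /=; apply/negP => /andP[/vertsP[y]]; rewrite !inE /=.
    by case/and3P => _ /negbTE->.
  have <- : #|verts g2 :|: C| = #|verts g2| + #|C| by rewrite cardsU disjoint_setI0 // cards0 subn0.
  apply: subset_leq_card; rewrite subUset verts_sub //=; apply/subsetP => x; rewrite inE.
  by case: cc => _ cc _; apply: cycle_verts cc _.
have [|||cs [Scs ccs pcs]] := IHj j (ltnSn j) g2 (ltnW jK) g2s.
- by move=> x; apply: contra (gi x); apply: (subsetP sub).
- by move=> x; apply: leq_trans (deg_sub x sub) (g3 x).
- have := cycle_remove gs g23 cc; rewrite -/C -/g2; move: ex cb v2.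
  by rewrite [j.+1 * _]mulSn; move: (j * (4 * i + 4)); clear; lia.
exists (c :: cs); split=> /=; first by rewrite Scs.
  move=> c'; rewrite inE => /orP[/eqP->//|/ccs[Uc cc' lc]].
  by split=> //; apply: cycle_subset sub cc'.
rewrite pcs andbT; apply/allP => c' /ccs[_ cc' _].
apply/pred0P => x /=; apply/negP => /andP[xc /(cycle_verts g2s cc')/vertsP[y]].
by rewrite !inE /= xc andbF.
Qed.

End Cubic.

(** * A maximal subcubic graph with long cycles *)

Section Cycles.
Variable T : finType.
Implicit Types (g h b : {set T * T}) (x y z u v a w : T) (p q s c : seq T).

Lemma next_closed c (P : T -> Prop) x : uniq c -> x \in c -> P x ->
  (forall y, y \in c -> P y -> P (next c y)) -> forall y, y \in c -> P y.
Proof.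
move=> Uc xc Px step; have [i p Ep] := rot_to xc.
have := cycle_next Uc; rewrite -(rot_cycle i) Ep /= => pp y.
rewrite -(mem_rot i) Ep => yp; have {yp} : y \in x :: rcons p x.
  by move: yp; rewrite !inE mem_rcons inE orbA orbb.
move: (rcons p x) pp => s pp; elim: s x xc Px pp {Ep} => [|z s IHs] w wc Pw /=; first by rewrite inE => _ /eqP->.
move=> /andP[/eqP Ez pz]; rewrite inE => /orP[/eqP->//|].
by apply: IHs => //; rewrite -Ez ?mem_next //; apply: step.
Qed.

Lemma prev_head x p : x \notin p -> prev (x :: p) x = last x p.
Proof.
suff H s y : x \notin s -> prev_at x x y s = last y s by apply: H.
elim: s y => [|z s IHs] y /=; first by rewrite eqxx.
by rewrite inE negb_or => /andP[/negbTE-> /IHs].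
Qed.

Lemma next_prev_neq c x : uniq c -> 2 < size c -> x \in c -> next c x != prev c x.
Proof.
move=> Uc c3 xc; apply/eqP => E.
have : next c (next c x) = x by rewrite E next_prev.
have [i p Ep] := rot_to xc; rewrite -!(next_rot i Uc) Ep.
have := Uc; rewrite -(rot_uniq i) Ep; have := c3; rewrite -(size_rot i) Ep.
case: p {Ep E} => [|y [|z p]] //= _; rewrite eqxx !inE !negb_or => /andP[/and3P[xy xz _] _].
by rewrite eq_sym (negbTE xy) eqxx => E; rewrite E eqxx in xz.
Qed.

Definition cdarts c : {set T * T} :=
  [set d | (d.1 \in c) && ((d.2 == next c d.1) || (d.2 == prev c d.1))].

Lemma cdarts_sym c : uniq c -> dsym (cdarts c).
Proof.
move=> Uc x y; rewrite !inE /= => /andP[xc /orP[]/eqP->].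
  by rewrite mem_next xc prev_next // eqxx orbT.
by rewrite mem_prev xc next_prev // eqxx.
Qed.

Lemma deg_cdarts c x : uniq c -> 2 < size c -> deg (cdarts c) x = if x \in c then 2 else 0.
Proof.
move=> Uc c3; case: ifP => xc; last by apply: eq_card0 => y; rewrite !inE /= xc.
have <- : #|[set next c x; prev c x]| = 2 by rewrite cards2 next_prev_neq.
by apply: eq_card => y; rewrite !inE /= xc.
Qed.

Lemma cdarts_cycle c : uniq c -> cycle (drel (cdarts c)) c.
Proof. by move=> Uc; apply: cycle_from_next => // x xc; rewrite /drel inE /= xc eqxx. Qed.

Lemma cdarts_subset h c : dsym h -> uniq c -> cycle (drel h) c -> cdarts c \subset h.
Proof.
move=> hs Uc hc; apply/subsetP => -[x y]; rewrite inE /= => /andP[xc /orP[]/eqP->].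
  exact: (next_cycle hc xc).
by apply: hs; apply: (prev_cycle hc xc).
Qed.

Lemma pdarts_cdarts x p : uniq (x :: p) -> pdarts x (rcons p x) \subset cdarts (x :: p).
Proof. by move=> U; rewrite pdarts_subset; [exact: (cdarts_cycle U) | exact: cdarts_sym]. Qed.

(** At a vertex of degree 2 a cycle uses both edges. *)
Lemma cycle_closed h c x y : dsym h -> long_cycle (drel h) 3 c -> x \in c -> deg h x = 2 ->
  (x, y) \in h -> y \in c.
Proof.
move=> hs hc xc dx xy; have [z [w [zw zc wc xz xw]]] := cycle_nbrs hs hc xc.
have sub : [set z; w] \subset nbrs h x by rewrite subUset !sub1set !inE xz xw.
have : y \in nbrs h x by rewrite inE.
have /eqP <- : [set z; w] == nbrs h x by rewrite eqEcard sub cards2 zw -dx leqnn.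
by rewrite !inE => /orP[]/eqP->.
Qed.

Lemma deg_setU g h x : [disjoint g & h] -> deg (g :|: h) x = deg g x + deg h x.
Proof.
move=> dgh; rewrite /deg -[RHS]subn0 -[X in _ - X](_ : #|nbrs g x :&: nbrs h x| = 0).
  by rewrite -cardsU; apply: eq_card => y; rewrite !inE.
apply: eq_card0 => y; rewrite !inE; case xy: ((x, y) \in g) => //=.
by rewrite (disjointFr dgh xy).
Qed.

Lemma deg_pdarts x p z : uniq (x :: p) ->
  deg (pdarts x p) z = (z \in belast x p) + (z \in p).
Proof.
elim: p x => [|y p IHp] x; first by move=> _; apply: eq_card0 => w; rewrite !inE.
rewrite cons_uniq => /andP[xyp Uyp]; have xy : x != y by move: xyp; rewrite inE negb_or => /andP[].
have -> : pdarts x (y :: p) = [set (x, y); (y, x)] :|: pdarts y p by rewrite /= setUA.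
rewrite deg_setU; last first.
  apply/pred0P => -[u v] /=; apply/negP => /andP[]; rewrite !inE !xpair_eqE.
  move=> uv /mem_pdarts/andP[up vp]; case/orP: uv => /andP[/eqP E1 /eqP E2].
    by rewrite -E1 up in xyp.
  by rewrite -E2 vp in xyp.
rewrite IHp // /= !inE.
have -> : deg [set (x, y); (y, x)] z = (z == x) + (z == y).
  rewrite /deg; have [zx|zx] := eqVneq z x.
    rewrite zx (negbTE xy) -[RHS](cards1 y); apply: eq_card => w.
    by rewrite !inE !xpair_eqE eqxx (negbTE xy) orbF.
  have [zy|zy] := eqVneq z y.
    rewrite zy -[RHS](cards1 x); apply: eq_card => w.
    by rewrite !inE !xpair_eqE eqxx eq_sym (negbTE xy).
  by apply: eq_card0 => w; rewrite !inE !xpair_eqE (negbTE zx) (negbTE zy).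
have xnp : (x \in belast y p) = false by apply: contraNF xyp => /mem_belast.
have ynp : (y \in p) = false by apply: contraTF Uyp => /= ->.
have xp : (x \in p) = false by move: xyp; rewrite inE negb_or => /andP[_ /negbTE].
case: eqVneq => [->|_] /=; first by rewrite xnp xp (negbTE xy).
by case: eqVneq => [->|_]; rewrite /= ?ynp !add0n ?addn0 1?addnC.
Qed.

Lemma ear_dart a a' p u v : p != [::] -> (u, v) \in pdarts a (rcons p a') -> (u \in p) || (v \in p).
Proof.
have H q y : (u, v) \in pdarts y (rcons q a') -> (u \in y :: q) || (v \in y :: q).
  elim: q y => [|z q IHq] y /=.
    by rewrite !inE !xpair_eqE orbF => /orP[]/andP[/eqP-> /eqP->]; rewrite eqxx ?orbT.
  rewrite !in_setU1 !xpair_eqE => /or3P[/andP[/eqP-> _]|/andP[_ /eqP->]|/IHq/orP[]];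
    by rewrite !inE ?eqxx ?orbT // => ->; rewrite ?orbT.
case: p => // y p _; rewrite /= !in_setU1 !xpair_eqE.
by move=> /or3P[/andP[_ /eqP->]|/andP[/eqP-> _]|/H//]; rewrite mem_head ?orbT.
Qed.

End Cycles.

(** * Consequences of maximality *)

Section Main.
Variables (T : finType) (l : nat) (E : {set T * T}).
Hypotheses (l3 : 2 < l) (Es : dsym E) (Ei : dirr E).
Hypothesis gap : forall c, long_cycle (drel E) l c -> 6 * l < size c.
Implicit Types (g b : {set T * T}) (x y z u v a w : T) (p q s c : seq T).

(** [long_cycle _ 3] ranges over all cycles, so the last clause excludes short cycles from [g]. *)
Definition subcubic g :=
  [/\ dsym g, g \subset E, {in verts g, forall x, (deg g x == 2) || (deg g x == 3)} &
      forall c, long_cycle (drel g) 3 c -> l <= size c].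

Lemma subcubic_max : exists2 h, subcubic h &
  forall g, subcubic g -> #|branch g| <= #|branch h| /\
    (#|branch g| = #|branch h| -> #|g| <= #|h|).
Proof.
(* The lexicographic order as one number: [#|g|] is at most the number of all pairs, so a single
   branch vertex outweighs it. *)
pose m g := #|branch g| * #|{: T * T}|.+1 + #|g|.
have c0 : (fun g => `[< subcubic g >]) set0.
  apply/asboolP; split=> [x y||x /vertsP[y]|c [_ cc c3]]; rewrite ?inE ?sub0set //.
  by case: c cc c3 => [|x [|y c]] //=; rewrite /drel inE.
case: (@arg_maxnP _ set0 (fun g => `[< subcubic g >]) m c0) => h /asboolP hh hmax; exists h => // g hg.
have := hmax g; rewrite asboolT // => /(_ isT).
have gs := max_card (mem g); have hs := max_card (mem h).
rewrite /m; move: gs hs.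
have <- : #|[set: T * T]| = #|{: T * T}| by rewrite cardsT.
move: #|branch g| #|branch h| => bg bh; move: #|g| #|h| #|[set: T * T]| => ng nh n.
clear; move=> gn hn le; split; last by move=> E; rewrite E in le; lia.
by rewrite leqNgt; apply/negP => lt; have := leq_mul lt (leqnn n.+1); rewrite mulSn; lia.
Qed.

Variable h : {set T * T}.
Hypothesis (hh : subcubic h).
Hypothesis hmax : forall g, subcubic g -> #|branch g| <= #|branch h| /\
    (#|branch g| = #|branch h| -> #|g| <= #|h|).

Let hs : dsym h. Proof. by case: hh. Qed.
Let hE : h \subset E. Proof. by case: hh. Qed.
Let h23 : {in verts h, forall x, (deg h x == 2) || (deg h x == 3)}. Proof. by case: hh. Qed.
Let hl c : long_cycle (drel h) 3 c -> l <= size c. Proof. by case: hh => _ _ _; apply. Qed.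
Let hi : dirr h. Proof. by move=> x; apply: contra (Ei x); apply: (subsetP hE). Qed.

Lemma deg0_notin x : x \notin verts h -> deg h x = 0.
Proof. by rewrite inE -eqn0Ngt => /eqP. Qed.

Lemma deg_vert x k : deg h x = k.+1 -> x \in verts h.
Proof. by rewrite inE => ->. Qed.

(** Adding the path to [h] would turn [a] and [a'] into branch vertices and keep all degrees at 2 or
    3. By maximality a short cycle must arise, and it runs through the whole ear. *)
Lemma ear_short a a' p : a != a' -> deg h a = 2 -> deg h a' = 2 ->
  path (drel E) a (rcons p a') -> uniq (a :: rcons p a') -> [disjoint p & verts h] ->
  (p = [::] -> (a, a') \notin h) ->
  exists q, [/\ path (drel h) a' (rcons q a), uniq (a :: p ++ a' :: q) & size p + size q + 2 < l].
Proof.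
move=> aa' da da' Ep Up dp ph; apply: contrapT => nq.
set P := pdarts a (rcons p a'); pose g := h :|: P.
have disP : [disjoint h & P].
  apply/pred0P => -[u v] /=; apply/negP => /andP[uvh uvP].
  case: (eqVneq p [::]) => [p0|p0].
    move: uvP uvh; rewrite /P p0 /= !inE !xpair_eqE orbF => /orP[]/andP[/eqP-> /eqP->].
      by rewrite (negbTE (ph p0)).
    by move=> /hs; rewrite (negbTE (ph p0)).
  case/orP: (ear_dart p0 uvP) => /(disjointFr dp); first by rewrite (vertsl uvh).
  by rewrite (vertsr hs uvh).
have degg z : deg g z = deg h z + ((z \in a :: p) + (z \in rcons p a')).
  by rewrite deg_setU // deg_pdarts // belast_rcons.
have ap : a \notin rcons p a' by case/andP: Up.
have a'p : a' \notin a :: p by move: Up; rewrite -rcons_cons rcons_uniq => /andP[].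
have dga : deg g a = 3 by rewrite degg da inE eqxx (negbTE ap).
have dga' : deg g a' = 3 by rewrite degg da' (negbTE a'p) mem_rcons inE eqxx.
have dgp z : z \in p -> deg g z = 2.
  move=> zp; rewrite degg deg0_notin ?(disjointFr dp zp) //.
  by rewrite inE mem_rcons inE zp !orbT.
have dgo z : z != a -> z != a' -> z \notin p -> deg g z = deg h z.
  move=> za za' zp; rewrite degg inE mem_rcons inE (negbTE za) (negbTE za') (negbTE zp).
  by rewrite addn0.
have gs : dsym g by apply: setU_sym => //; apply: pdarts_sym.
have gg : subcubic g.
  split=> //.
  - by rewrite subUset hE pdarts_subset.
  - move=> z; have [->|za] := eqVneq z a; first by rewrite dga.
    have [->|za'] := eqVneq z a'; first by rewrite dga'.
    have [zp|zp] := boolP (z \in p); first by rewrite dgp.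
    by rewrite inE dgo // => dz; apply: h23; rewrite inE.
  - move=> c [Uc cc c3]; rewrite leqNgt; apply/negP => cl.
    have [hc|nhc] := boolP (cycle (drel h) c).
      by have : l <= size c by [apply: hl]; rewrite leqNgt cl.
    have [q [hq Uq sq]] := ear_cycle hs Up dp Uc c3 cc nhc.
    by apply: nq; exists q; split=> //; rewrite -sq.
have [+ _] := hmax gg; apply/negP; rewrite -ltnNge.
apply: (@leq_trans #|a |: branch h|); first by rewrite cardsU1 inE da.
apply: subset_leq_card; rewrite subUset sub1set inE dga /=.
apply/subsetP => z; rewrite !inE => /eqP dz.
have [->|za] := eqVneq z a; first by rewrite dga.
have [->|za'] := eqVneq z a'; first by rewrite dga'.
have zp : z \notin p by apply/negP => /(disjointFr dp); rewrite (deg_vert dz).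
by rewrite dgo // dz.
Qed.

(** A long cycle disjoint from [h] could be added to it: no new branch vertex, but more edges. This
    uses the second criterion in the choice of [h]. *)
Lemma long_meets c : long_cycle (drel E) l c -> exists2 x, x \in c & x \in verts h.
Proof.
move=> [Uc cc lc]; apply: contrapT => nc.
have c3 : 2 < size c by apply: leq_trans lc.
have nv x : x \in c -> x \notin verts h by move=> xc; apply/negP => xv; apply: nc; exists x.
pose g := h :|: cdarts c.
have dis : [disjoint h & cdarts c].
  apply/pred0P => -[u v] /=; apply/negP => /andP[/vertsl uv]; rewrite inE /= => /andP[uc _].
  by have := nv _ uc; rewrite uv.
have degg z : deg g z = if z \in c then 2 else deg h z.
  rewrite deg_setU // deg_cdarts //; case: ifP => zc; last by rewrite addn0.
  by rewrite deg0_notin // nv.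
have gs : dsym g by apply: setU_sym => //; apply: cdarts_sym.
have gg : subcubic g.
  split=> //.
  - by rewrite subUset hE cdarts_subset.
  - move=> z; rewrite inE degg; case: ifP => // _ dz; apply: h23; rewrite inE //.
  - move=> c' gc'; have [Uc' cc' c'3] := gc'.
    (* A cycle of [g] that meets [c] contains all of [c], whose vertices have degree 2 in [g]; any
       other one is a cycle of [h]. *)
    have [cc0|] := pselect (exists2 x, x \in c' & x \in c).
      have [x xc' xc] := cc0; apply: leq_trans lc _; apply: uniq_leq_size => // y yc.
      apply: (next_closed (P := fun y => y \in c') Uc xc xc' _ yc) => z zc zc'.
      apply: (cycle_closed gs gc' zc'); first by rewrite degg zc.
      by rewrite !inE /= zc eqxx orbT.
    move=> nc'; apply: hl; split=> //.
    apply: (@sub_in_cycle _ [predC mem c] (drel g)) cc'.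
      by move=> x y /= xc yc; rewrite /drel !inE /= => /orP[//|/andP[xc']]; rewrite inE xc' in xc.
    by apply/allP => x xc' /=; apply/negP => xc; apply: nc'; exists x.
have [_ H] := hmax gg.
have : #|branch g| = #|branch h|.
  apply: eq_card => z; rewrite !inE degg; case: ifP => // zc.
  by rewrite deg0_notin // nv.
move=> /H; apply/negP; rewrite -ltnNge.
case: c Uc cc lc c3 nc nv @g dis degg gs gg H => // x c Uc cc lc c3 nc nv g dis degg gs gg H.
have d0 : (x, next (x :: c) x) \in cdarts (x :: c) by rewrite inE /= mem_head !eqxx.
have <- : #|h| + #|cdarts (x :: c)| = #|g| by rewrite cardsU disjoint_setI0 // cards0 subn0.
by rewrite -[X in X < _]addn0 ltn_add2l card_gt0; apply/set0Pn; exists (x, next (x :: c) x).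
Qed.

Definition touching v c := [/\ long_cycle (drel E) l c, v \in c, deg h v = 2 &
  forall z, z \in c -> z \in verts h -> z = v].

(** If they met, [c'] could be followed from [v'] to its first vertex [w] on [c], and then [c] in
    either direction to [v]. Both routes are paths off [h], so by [ear_short] both arcs of [c] have
    fewer than [l] inner vertices, which contradicts the gap. *)
Lemma touching_disjoint v v' c c' : touching v c -> touching v' c' -> v != v' ->
  [disjoint c & c'].
Proof.
move=> [lc vc dv cv] [lc' vc' dv' cv'] vv'; apply/pred0P => z /=; apply/negP => /andP[zc zc'].
have v'c : v' \notin c.
  by apply/negP => v'c; have := cv _ v'c (deg_vert dv') => E'; rewrite E' eqxx in vv'.
have vc'' : v \notin c'.
  by apply/negP => vc''; have := cv' _ vc'' (deg_vert dv) => E'; rewrite E' eqxx in vv'.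
have [Uc cc szc] := lc; have [Uc' cc' szc'] := lc'.
have big := gap lc.
have [i' p' Ep'] := rot_to vc'.
have Up' : uniq (v' :: p') by rewrite -Ep' rot_uniq.
have pp' : path (drel E) v' (rcons p' v') by have := cc'; rewrite -(rot_cycle i') Ep'.
have mp' x : (x \in c') = (x \in v' :: p') by rewrite -Ep' mem_rot.
have zp' : z \in p'.
  by move: zc'; rewrite mp' inE => /orP[/eqP zv|//]; rewrite -zv zc in v'c.
have [w [s [t [Ew wc nsc]]]] : exists w s t, [/\ p' = s ++ w :: t, w \in c & ~~ has (mem c) s].
  have : has (mem c) p' by apply/hasP; exists z.
  by case/split_find => w s t wc ns; exists w, s, t; rewrite cat_rcons.
have wc' : w \in c' by rewrite mp' Ew !inE mem_cat inE eqxx !orbT.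
have wv : w != v by apply: contraNneq vc'' => <-.
have pw : path (drel E) v' (rcons s w).
  by move: pp'; rewrite Ew rcons_cat rcons_cons path_split => /andP[].
have sc' x : x \in s -> x \in c' by move=> xs; rewrite mp' Ew inE mem_cat xs !orbT.
have Usw : uniq (v' :: rcons s w).
  by move: Up'; rewrite Ew -cat_rcons -cat_cons cat_uniq => /and3P[].
have short q : path (drel E) w (rcons q v) -> uniq (w :: rcons q v) -> {subset q <= c} ->
    v \notin q -> size q < l.
  move=> pq Uq qc vq.
  have Up : uniq (v' :: rcons (s ++ w :: q) v).
    rewrite rcons_cat rcons_cons -cat_rcons -cat_cons cat_uniq Usw.
    have -> : uniq (rcons q v) by case/andP: Uq.
    rewrite andbT; apply/hasPn => x xq /=.
    have xc : x \in c by move: xq; rewrite mem_rcons inE => /orP[/eqP->|/qc].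
    rewrite inE mem_rcons inE !negb_or; apply/and3P; split.
    - by apply: contraNneq v'c => <-.
    - by apply: contraTneq Uq => <-; rewrite cons_uniq xq.
    - by apply: contra nsc => xs; apply/hasP; exists x.
  have dp : [disjoint s ++ w :: q & verts h].
    apply/pred0P => x /=; apply/negP; rewrite mem_cat inE => /andP[/or3P[xs|/eqP->|xq] xv].
    - have := cv' _ (sc' _ xs) xv => xv'.
      by move: Up; rewrite cons_uniq mem_rcons inE mem_cat -xv' xs !orbT.
    - by have := cv _ wc; move: xv => + H; move=> ?; rewrite H ?eqxx in wv.
    - by have := cv _ (qc _ xq) xv => xv'; rewrite -xv' xq in vq.
  have v'v : v' != v by rewrite eq_sym.
  have [||q' [_ _]] := ear_short v'v dv' dv _ Up dp; last by rewrite size_cat /=; clear; lia.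
    by rewrite rcons_cat rcons_cons path_split pw.
  by case: (s).
have [i p Ep] := rot_to vc.
have Up : uniq (v :: p) by rewrite -Ep rot_uniq.
have pp : path (drel E) v (rcons p v) by have := cc; rewrite -(rot_cycle i) Ep.
have mp x : (x \in c) = (x \in v :: p) by rewrite -Ep mem_rot.
have szp : size c = (size p).+1 by rewrite -(size_rot i) Ep.
have wp : w \in p by move: wc; rewrite mp inE (negbTE wv).
case/splitPr: wp Up pp mp szp {Ep} => p1 p2 Up pp mp szp.
move: pp; rewrite rcons_cat rcons_cons path_split => /andP[pp1 pp2].
have [vp Ucat] : v \notin p1 ++ w :: p2 /\ uniq (p1 ++ w :: p2) by apply/andP.
have [vp1 vp2] : v \notin p1 /\ v \notin w :: p2.
  by move: vp; rewrite mem_cat negb_or => /andP[].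
have l1 : size (rev p1) < l.
  apply: short.
  - by rewrite -path_rev.
  - have Uw : uniq (v :: rcons p1 w).
      rewrite cons_uniq mem_rcons inE negb_or eq_sym wv vp1.
      by move: Ucat; rewrite -cat_rcons cat_uniq => /andP[].
    by move: (Uw); rewrite (uniq_rcons_rev v p1 w).
  - by move=> x; rewrite mem_rev mp inE mem_cat => ->; rewrite orbT.
  - by rewrite mem_rev.
have l2 : size p2 < l.
  apply: short => //.
  - by rewrite -rcons_cons rcons_uniq vp2; move: Ucat; rewrite cat_uniq => /and3P[].
  - by move=> x xp; rewrite mp !inE mem_cat inE xp !orbT.
  - by move: vp2; rewrite inE negb_or => /andP[].
by move: l1 l2 big; rewrite szp size_cat size_rev /=; clear; lia.
Qed.

(** * Blocks along a long cycle *)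

Notation mblock := (maxblock l E).

Lemma maxblock_cdarts B c : mblock B -> long_cycle (drel E) 3 c -> size c < l ->
  forall d, d \in cdarts c -> d \in B -> cdarts c \subset B.
Proof.
move=> mB [Uc cc c3] cl [x y] xyc xyB; have [[Bs _ _ _] _] := mB.
suff [z zc zB] : exists2 z, z \in c & (z, next c z) \in B.
  apply: cdarts_subset => //; apply: cycle_from_next => // u uc.
  have szc : 2 < size c < l by rewrite c3 cl.
  exact: (maxblock_cycle l3 Es Ei gap mB Uc cc szc zc zB uc).
move: xyc; rewrite inE /= => /andP[xc /orP[/eqP Ey|/eqP Ey]]; first by exists x; rewrite -?Ey.
by exists y; rewrite Ey ?mem_prev ?next_prev // -Ey; apply: Bs.
Qed.

(** The piece [s] off [h] has a substitute [q] in [h]. Together they form a short cycle, or both are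
    the same edge of [h]; hence a maximal block that contains one of their darts contains all. *)
Lemma shadow a a' s : a != a' -> deg h a = 2 -> deg h a' = 2 ->
  path (drel E) a (rcons s a') -> uniq (a :: rcons s a') -> [disjoint s & verts h] ->
  exists q, [/\ path (drel h) a (rcons q a'), uniq (a :: rcons q a') &
    forall B, mblock B -> forall d, d \in pdarts a (rcons s a') :|: pdarts a (rcons q a') ->
      d \in B -> pdarts a (rcons s a') :|: pdarts a (rcons q a') \subset B].
Proof.
move=> aa' da da' Ep Up ds.
have [/andP[/eqP s0 aa'h]|nh] := boolP ((s == [::]) && ((a, a') \in h)).
  exists [::]; rewrite s0 setUid; split; [by rewrite /= andbT | by rewrite /= inE aa' |].
  move=> B [[Bs _ _ _] _] d; rewrite /= setU0 !inE.
  by move=> /orP[]/eqP-> dB; rewrite subUset !sub1set dB Bs.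
have [|q [hq Uq szq]] := ear_short aa' da da' Ep Up ds.
  by move=> s0; move: nh; rewrite s0 eqxx.
exists (rev q); rewrite -path_rev // hq; split=> //.
  have : uniq (a' :: rcons q a).
    rewrite -rcons_cons rcons_uniq; move: Uq; rewrite cons_uniq mem_cat negb_or cat_uniq.
    by move=> /and3P[/andP[_ ->] _ /andP[_ ->]].
  by rewrite uniq_rcons_rev.
have -> : pdarts a (rcons (rev q) a') = pdarts a' (rcons q a).
  by rewrite -(pdarts_rev a' (rcons q a)) last_rcons belast_rcons rev_cons.
have -> : pdarts a (rcons s a') :|: pdarts a' (rcons q a) =
    pdarts a (rcons (s ++ a' :: q) a).
  by rewrite rcons_cat rcons_cons -cat_rcons pdarts_cat last_rcons.
have Ehq := path_subset hE hq.
have lc : long_cycle (drel E) 3 (a :: s ++ a' :: q).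
  split=> //; first by rewrite /= rcons_cat rcons_cons path_split Ep.
  rewrite /= size_cat /= addnS !ltnS; case: s nh Ep Up ds Uq szq => [|? ?] //= nh _ _ _ Uq _.
  case: q hq {Uq Ehq} => //=; rewrite andbT /drel => /hs a'h.
  by rewrite a'h in nh.
have cl : size (a :: s ++ a' :: q) < l.
  by move: szq; rewrite addn2 /= size_cat /= addnS.
have Ecd : pdarts a (rcons (s ++ a' :: q) a) = cdarts (a :: s ++ a' :: q).
  apply/eqP; rewrite eqEsubset pdarts_cdarts // cdarts_subset //; first exact: pdarts_sym.
  exact: (@path_pdarts _ a (rcons (s ++ a' :: q) a)).
by rewrite Ecd => B mB d dc dB; apply: maxblock_cdarts mB lc cl d dc dB.
Qed.

(** The two edges of [h] at [y] are told apart by some maximal block. *)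
Definition changing y := deg h y = 2 /\ exists z z' B,
  [/\ (y, z) \in h, (y, z') \in h, mblock B, (y, z) \in B & (y, z') \notin B].

Lemma inner_darts a a' q y z : path (drel h) a (rcons q a') -> uniq (a :: rcons q a') ->
  y \in q -> deg h y = 2 -> (y, z) \in h -> (y, z) \in pdarts a (rcons q a').
Proof.
move=> hq Uq yq dy yz; have sub : pdarts a (rcons q a') \subset h by rewrite pdarts_subset.
have : nbrs (pdarts a (rcons q a')) y == nbrs h y.
  rewrite eqEcard; apply/andP; split.
    by apply/subsetP => u; rewrite !inE; apply: (subsetP sub).
  rewrite -/(deg h y) -/(deg _ y) dy deg_pdarts // belast_rcons inE mem_rcons inE yq !orbT //.
by move=> /eqP/setP/(_ z); rewrite !inE yz.
Qed.

(** An inner vertex of degree 2 has both its edges on the path, and these lie in the same maximal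
    blocks. *)
Lemma changing_not_inner a a' q y (D : {set T * T}) : path (drel h) a (rcons q a') ->
  uniq (a :: rcons q a') ->
  (forall B, mblock B -> forall d, d \in D :|: pdarts a (rcons q a') ->
      d \in B -> D :|: pdarts a (rcons q a') \subset B) ->
  changing y -> y \notin q.
Proof.
move=> hq Uq HB [dy [z [z' [B [yz yz' mB zB]]]]]; apply: contra => yq.
have zD := inner_darts hq Uq yq dy yz; have z'D := inner_darts hq Uq yq dy yz'.
apply: (subsetP (HB B mB _ _ zB)); first by rewrite inE zD orbT.
by rewrite inE z'D orbT.
Qed.

(** The connected components of this graph are the degree-2 components of [h]. *)
Definition deg2 := [set d in h | (deg h d.1 == 2) && (deg h d.2 == 2)].

Lemma avoid_connect x p y z : path (drel h) x p -> y \notin x :: p -> z \notin x :: p ->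
  connect (drel (rmv (rmv h y) z)) x (last x p).
Proof. by move=> hp yp zp; apply: path_connect_last; exact: path_rmv (path_rmv hp yp) zp. Qed.

(* A detour around [y] closes to a cycle of [h], which contains the whole
   degree-2 component of [y]. *)
Lemma detour y z u v : (y, u) \in h -> (y, v) \in h -> u != v -> z != y ->
  connect (drel (rmv (rmv h y) z)) u v -> connect (drel deg2) y z -> False.
Proof.
move=> yu yv uv zy /connect_uniq[p [hp Up lp]] cyz.
have p0 : p != [::] by apply: contraNneq uv => p0; rewrite -lp p0.
have yneq w : (y, w) \in h -> y != w by move=> yw; apply: contraTneq yw => ->; apply: hi.
have hyp := path_subset (rmv_sub _ z) hp.
have yp := path_rmv_notin hyp (yneq _ yu).
have zu : z != u.
  case: p p0 hp {Up lp hyp yp} => // w p _ /=; rewrite {1}/drel inE /= => /andP[/and3P[_ uz _] _].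
  by rewrite eq_sym.
have zp := path_rmv_notin hp zu.
have hup := path_subset (rmv_sub _ y) hyp.
have cyc : long_cycle (drel h) 3 (y :: u :: p).
  split; first by rewrite cons_uniq yp.
    by rewrite (cycle_path y) /= lp hup [drel h v y](hs yv) [drel h y u]yu.
  by case: p p0 {hp Up lp hyp yp zp hup}.
case/connectP: cyz => t ht zt.
have : {subset y :: t <= y :: u :: p}.
  have : y \in y :: u :: p by rewrite mem_head.
  move: {zt yu yv yneq} ht; move: {1 2 4}y; elim: t => [|w t IHt] x /=.
    by move=> _ xc z'; rewrite inE => /eqP->.
  rewrite {1}/drel inE /= => /andP[/and3P[xw /eqP dx _] wt] xc z'.
  rewrite inE => /orP[/eqP->//|]; apply: IHt => //.
  exact: cycle_closed cyc xc dx xw.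
move=> /(_ z); rewrite {1}zt mem_last => /(_ isT).
by rewrite inE (negbTE zy) (negbTE zp).
Qed.

(** Each piece of the walk off [h] is replaced by its shadow. The ends of a shadow are on the walk,
    and its inner vertices are not changing, so it avoids [y] and [z]. *)
Lemma walk_connect y z x t : changing y -> changing z -> path (drel E) x t -> uniq (x :: t) ->
  x \in verts h -> last x t \in verts h ->
  {in x :: t, forall w, [/\ w != y, w != z & w \notin branch h]} ->
  connect (drel (rmv (rmv h y) z)) x (last x t).
Proof.
move=> cy cz + + xv lv; move: x t xv lv.
apply: (@seg_elim _ (mem (verts h))) => [x _ _ _|x s a t xv av ns IHt]; first exact: connect0.
rewrite path_split => /andP[Es1 Et] Uxt good; rewrite last_cat /=.
have good' w : w \in verts h -> w \in x :: s ++ a :: t -> deg h w = 2.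
  move=> wv /good[_ _]; rewrite inE; case/orP: (h23 wv) => /eqP-> //.
have xin : x \in x :: s ++ a :: t by rewrite mem_head.
have ain : a \in x :: s ++ a :: t by rewrite !(inE, mem_cat) eqxx !orbT.
have := Uxt; rewrite -cat_cons cat_uniq => /and3P[_ nsa Uat].
have Uxa : uniq (x :: rcons s a).
  by move: Uxt; rewrite -cat_rcons -cat_cons cat_uniq => /and3P[].
have xa : x != a by apply: contraTneq Uxa => ->; rewrite cons_uniq mem_rcons mem_head.
have ds : [disjoint s & verts h] by rewrite disjoint_has.
have [q [hq Uq HB]] := shadow xa (good' _ xv xin) (good' _ av ain) Es1 Uxa ds.
apply: connect_trans (IHt Et Uat _); last first.
  by move=> w wat; apply: good; rewrite inE mem_cat wat !orbT.
have [xy xz _] := good _ xin; have [ay az _] := good _ ain.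
have := @avoid_connect x (rcons q a) y z hq; rewrite last_rcons; apply.
  by rewrite inE mem_rcons inE !negb_or !(eq_sym y) xy ay; apply: changing_not_inner hq Uq HB cy.
by rewrite inE mem_rcons inE !negb_or !(eq_sym z) xz az; apply: changing_not_inner hq Uq HB cz.
Qed.

Lemma split_last (A : {set T}) c : has (mem A) c ->
  exists s a t, [/\ c = s ++ a :: t, a \in A & ~~ has (mem A) t].
Proof.
rewrite -has_rev => /split_find Hs; have -> : c = rev (rev c) by rewrite revK.
case: Hs => a s t aA ns; exists (rev t), a, (rev s).
by rewrite rev_cat rev_rcons has_rev.
Qed.

Lemma split_first (A : {set T}) c : has (mem A) c ->
  exists s a t, [/\ c = s ++ a :: t, a \in A & ~~ has (mem A) s].
Proof. by case/split_find => a s t aA ns; exists s, a, t; rewrite cat_rcons. Qed.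

Variable Z : {set T}.
(** The chosen vertices are changing themselves, which keeps the inner vertices of shadows away from
    them. *)
Hypothesis HZ : forall y, changing y -> exists z, [/\ z \in Z, changing z & connect (drel deg2) y z].

(** The default [a'] is the right value: with [s] empty, the path goes directly from [a] to [a']. *)
Lemma dart_head a s a' : (a, head a' s) \in pdarts a (rcons s a').
Proof. by case: s => [|x s] /=; rewrite !inE eqxx. Qed.

Lemma dart_last a s a' : (last a s, a') \in pdarts a (rcons s a').
Proof. by rewrite pdarts_rcons !inE eqxx !orbT. Qed.

Lemma head_cat_cons x0 s a t : head x0 (s ++ a :: t) = head a s.
Proof. by case: s. Qed.

(** Blocks do not change along the cycle at [y]. If [y] is off [h], both edges belong to one piece
    with its shadow. If [y] is on [h], a change would make [y] changing, and the shadows of the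
    cycle would form a detour around [y] and the chosen vertex [z] of its component. *)
Lemma junction y c : long_cycle (drel E) l (y :: c) ->
  {in y :: c, forall x, x \notin branch h} -> {in y :: c, forall x, x \notin Z} ->
  (exists u v, [/\ u != v, u \in y :: c, v \in y :: c, u \in verts h & v \in verts h]) ->
  forall B, mblock B -> ((y, head y c) \in B) = ((y, last y c) \in B).
Proof.
move=> [Uc cc _] nb nZ [u [v [uv uc vc uV vV]]] B mB.
have [[Bs _ _ _] _] := mB.
have d2 w : w \in y :: c -> w \in verts h -> deg h w = 2.
  move=> /nb + wv; rewrite inE; case/orP: (h23 wv) => /eqP-> //.
have hasc : has (mem (verts h)) c.
  apply/hasP; case: (eqVneq u y) uc => [uy _|uy].
    exists v => //; move: vc; rewrite inE => /orP[/eqP vy|//].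
    by rewrite uy vy eqxx in uv.
  by rewrite inE (negbTE uy) /= => uc; exists u.
have [s1 [b1 [c3 [Ec b1V ns1]]]] := split_first hasc.
have yc : y \notin c by case/andP: Uc.
have pc : path (drel E) y (rcons c y) by [].
have b1c : b1 \in y :: c by rewrite Ec !(inE, mem_cat) eqxx !orbT.
have same a a' (D : {set T * T}) d d' : (forall B, mblock B -> forall d, d \in D -> d \in B -> D \subset B) ->
   d \in D -> d' \in D -> (d \in B) = (d' \in B).
  by move=> H dD d'D; apply/idP/idP => H'; [apply: (subsetP (H B mB d dD H')) | apply: (subsetP (H B mB d' d'D H'))].
(* Off [h], the two contacts of the cycle with [h] differ from [y]; so the last contact [bm] and the
   first contact [b1] are distinct, and [y] is inside the piece between them. *)
have [yV|yV] := boolP (y \in verts h); last first.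
  have hasc3 : has (mem (verts h)) c3.
    have notin w : w \in y :: c -> w \in verts h -> w != b1 -> w \in c3.
      rewrite Ec inE mem_cat inE => /or4P[/eqP->|ws|/eqP->|//] wV; rewrite ?eqxx //.
        by rewrite wV in yV.
      by case/negP: ns1; apply/hasP; exists w.
    apply/hasP; have [ub|ub] := eqVneq u b1; last by exists u => //; apply: notin.
    by exists v => //; apply: notin => //; rewrite -ub eq_sym.
  have [c4 [bm [sm [Ec3 bmV nsm]]]] := split_last hasc3.
  have bmc : bm \in y :: c by rewrite Ec Ec3 !(inE, mem_cat) eqxx !orbT.
  have Ep : path (drel E) bm (rcons (sm ++ y :: s1) b1).
    move: (pc); rewrite Ec Ec3 rcons_cat rcons_cons path_split rcons_cat rcons_cons.
    by rewrite path_split rcons_cat rcons_cons path_split => /and3P[-> _ ->].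
  have Up : uniq (bm :: rcons (sm ++ y :: s1) b1).
    have : uniq ((y :: rcons s1 b1) ++ c4 ++ (bm :: sm)) by rewrite cat_cons cat_rcons -Ec3 -Ec.
    by rewrite uniq_catCA cat_uniq uniq_catC rcons_cat => /and3P[].
  have b1m : bm != b1 by apply: contraTneq Up => ->; rewrite cons_uniq mem_rcons mem_head.
  have dp : [disjoint sm ++ y :: s1 & verts h].
    rewrite disjoint_has has_cat /= !negb_or nsm ns1 andbT //.
  have [q [hq Uq HB]] := shadow b1m (d2 _ bmc bmV) (d2 _ b1c b1V) Ep Up dp.
  have -> : head y c = head b1 s1 by rewrite Ec head_cat_cons.
  have -> : last y c = last bm sm by rewrite Ec Ec3 last_cat /= last_cat.
  rewrite (dsymE Bs y (last bm sm)); apply: same HB _ _; rewrite ?y //.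
    by rewrite inE rcons_cat rcons_cons -cat_rcons pdarts_cat last_rcons inE dart_head !orbT.
  by rewrite inE rcons_cat rcons_cons -cat_rcons pdarts_cat !inE dart_last.
(* Here the last contact [bm] may coincide with [b1], so the search includes [b1]. *)
have [c4 [bm [sm [Ec3 bmV nsm]]]] : exists s a t, [/\ b1 :: c3 = s ++ a :: t, a \in verts h & ~~ has (mem (verts h)) t].
  by apply: split_last; rewrite /= b1V.
have Ec' : c = s1 ++ c4 ++ bm :: sm by rewrite Ec Ec3.
have bmc : bm \in y :: c by rewrite Ec' !(inE, mem_cat) eqxx !orbT.
have yin : y \in y :: c by rewrite mem_head.
have pE1 : path (drel E) y (rcons s1 b1).
  by move: (pc); rewrite Ec rcons_cat rcons_cons path_split => /andP[].
have pEm : path (drel E) bm (rcons sm y).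
  by move: (pc); rewrite Ec' catA rcons_cat rcons_cons path_split => /andP[].
have U1 : uniq (y :: rcons s1 b1).
  by move: Uc; rewrite Ec -cat_rcons -cat_cons cat_uniq => /andP[].
have Um : uniq (bm :: rcons sm y).
  rewrite -rcons_cons rcons_uniq; move: Uc; rewrite Ec' catA cons_uniq mem_cat negb_or cat_uniq.
  by move=> /andP[/andP[_ ->] /and3P[_ _ ->]].
have yb1 : y != b1 by apply: contraTneq U1 => ->; rewrite cons_uniq mem_rcons mem_head.
have bmy : bm != y by apply: contraTneq Um => ->; rewrite cons_uniq mem_rcons mem_head.
have ds1 : [disjoint s1 & verts h] by rewrite disjoint_has.
have dsm : [disjoint sm & verts h] by rewrite disjoint_has.
have [q1 [hq1 Uq1 HB1]] := shadow yb1 (d2 _ yin yV) (d2 _ b1c b1V) pE1 U1 ds1.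
have [qm [hqm Uqm HBm]] := shadow bmy (d2 _ bmc bmV) (d2 _ yin yV) pEm Um dsm.
have -> : head y c = head b1 s1 by rewrite Ec head_cat_cons.
have -> : last y c = last bm sm by rewrite Ec' !last_cat.
(* Each edge of the cycle at [y] lies in the same maximal blocks as the edge by which the
   corresponding shadow leaves [y]. *)
have -> : ((y, head b1 s1) \in B) = ((y, head b1 q1) \in B).
  by apply: (same y y) HB1 _ _; rewrite inE dart_head ?orbT.
have -> : ((y, last bm sm) \in B) = ((y, last bm qm) \in B).
  rewrite !(dsymE Bs y); by apply: (same y y) HBm _ _; rewrite inE dart_last ?orbT.
have yf : (y, head b1 q1) \in h.
  by have := dart_head y q1 b1; apply: (subsetP _); rewrite pdarts_subset.
have yg : (y, last bm qm) \in h.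
  by apply: hs; have := dart_last bm qm y; apply: (subsetP _); rewrite pdarts_subset.
have [->//|fg] := eqVneq (head b1 q1) (last bm qm).
apply/eqP; apply: contrapT => neq.
have cy : changing y.
  split; first exact: d2.
  case fB: ((y, head b1 q1) \in B) neq; case gB: ((y, last bm qm) \in B) => // _.
    by exists (head b1 q1), (last bm qm), B; rewrite fB gB.
  by exists (last bm qm), (head b1 q1), B; rewrite fB gB.
have [z [zZ cz yz]] := HZ cy.
have zc w : w \in y :: c -> w != z by move=> /nZ; apply: contraNneq => ->.
have zy : z != y by rewrite eq_sym zc.
apply: (detour yf yg fg zy _ yz).
have yq1 : y \notin rcons q1 b1 by case/andP: Uq1.
have zq1 : z \notin rcons q1 b1.
  rewrite mem_rcons inE negb_or eq_sym zc //.
  exact: changing_not_inner hq1 Uq1 HB1 cz.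
have step1 : connect (drel (rmv (rmv h y) z)) (head b1 q1) b1.
  case: (q1) hq1 yq1 zq1 => [|x q] /=; first by rewrite connect0.
  by move=> /andP[_ hq] yq zq; have := avoid_connect hq yq zq; rewrite last_rcons.
have yqm : y \notin bm :: qm by move: Uqm; rewrite -rcons_cons rcons_uniq => /andP[].
have zqm : z \notin bm :: qm.
  rewrite inE negb_or eq_sym zc //; exact: changing_not_inner hqm Uqm HBm cz.
have stepm : connect (drel (rmv (rmv h y) z)) bm (last bm qm).
  by apply: avoid_connect => //; move: hqm; rewrite rcons_path => /andP[].
(* The detour: the first shadow from its second vertex to [b1], the shadows of the cycle between
   [b1] and [bm], and the last shadow back to its vertex before [y]. *)
apply: connect_trans step1 _; apply: connect_trans stepm.
have [t [Et lt]] : exists t, b1 :: t = rcons c4 bm /\ last b1 t = bm.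
  case: c4 Ec3 {Ec'} => [|w c4] [<- _]; first by exists [::].
  by exists (rcons c4 bm); rewrite last_rcons.
have Ec5 : c = s1 ++ (b1 :: t) ++ sm by rewrite Et cat_rcons Ec'.
have Ec4 : y :: c = y :: s1 ++ (b1 :: t) ++ sm by rewrite Ec5.
rewrite -lt; apply: (walk_connect cy cz).
- move: pc; rewrite (_ : c = s1 ++ b1 :: (t ++ sm)).
    by rewrite rcons_cat rcons_cons path_split rcons_cat cat_path => /and3P[].
  by case: Ec4.
- by move: Uc; rewrite Ec4 -cat_cons cat_uniq => /and3P[_ _]; rewrite cat_uniq => /and3P[].
- done.
- by rewrite lt.
- move=> w wt; have wc : w \in c.
    by rewrite Ec5 !(mem_cat w) wt orbT.
  have wyc : w \in y :: c by rewrite inE wc orbT.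
  split; [by apply: contraNneq yc => <- | exact: zc | exact: nb].
Qed.

(** The maximal block of one edge of [c] is carried around [c] by [junction], so it would contain
    the long cycle [c]. *)
Lemma no_long_cycle c : long_cycle (drel E) l c ->
  {in c, forall x, x \notin branch h} -> {in c, forall x, x \notin Z} ->
  (exists u v, [/\ u != v, u \in c, v \in c, u \in verts h & v \in verts h]) -> False.
Proof.
move=> lc nb nZ two; have [Uc cc szc] := lc.
have [u [v [_ uc _ _ _]]] := two.
have [B mB uB] := maxblock_edge l3 Es (next_cycle cc uc).
have [[Bs _ _ Bl] _] := mB; apply: (Bl c); split=> //.
apply: cycle_from_next => // x; apply: (next_closed (P := fun x => (x, next c x) \in B) Uc uc uB).
move=> y yc yB; set z := next c y; have zc : z \in c by rewrite mem_next.
have [i p Ep] := rot_to zc; have mp w : (w \in z :: p) = (w \in c) by rewrite -Ep mem_rot.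
have Up : uniq (z :: p) by rewrite -Ep rot_uniq.
have lp : last z p = y.
  by rewrite -prev_head; [rewrite -Ep prev_rot // prev_next | case/andP: Up].
have hp : head z p = next c z.
  rewrite -(next_rot i Uc) Ep; case: (p) => [|w q] /=; first by rewrite eqxx.
  by rewrite eqxx.
rewrite -hp (junction _ _ _ _ mB).
- by rewrite lp; apply: Bs.
- by rewrite -Ep; split; rewrite ?rot_uniq ?rot_cycle ?size_rot.
- by move=> w; rewrite mp; apply: nb.
- by move=> w; rewrite mp; apply: nZ.
- by have [a [a' H]] := two; exists a, a'; rewrite !mp.
Qed.

End Main.

(** * Size of the hitting set *)

Section Packings.
Variable T : finType.
Implicit Types (g h : {set T * T}) (A : {set T}).

Lemma sym_card_even g : dsym g -> dirr g -> ~~ odd #|g|.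
Proof.
have [n] := ubnP #|g|; elim: n g => // n IHn g gn gs gi.
have [->|/set0Pn[[x y] xy]] := eqVneq g set0; first by rewrite cards0.
have E := card_rem_edge gs gi xy; rewrite E oddD addbF; apply: IHn.
- by move: gn; rewrite E; clear; lia.
- exact: rem_edge_sym.
- by move=> z; rewrite inE (negbTE (gi z)) andbF.
Qed.

Lemma packing_set (r : rel T) l A (f : T -> seq T) k : k <= #|A| ->
  {in A, forall z, long_cycle r l (f z)} ->
  {in A &, forall z z', z != z' -> [disjoint f z & f z']} -> packing r l k.
Proof.
move=> kA fl fd; exists (map f (take k (enum A))); split.
- by rewrite size_map size_takel // -cardE.
- by move=> c /mapP[z /mem_take zA ->]; apply: fl; rewrite -mem_enum.
- rewrite pairwise_map; have : {subset take k (enum A) <= A}.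
    by move=> z /mem_take; rewrite mem_enum.
  have := take_uniq k (enum_uniq A).
  elim: (take k (enum A)) => //= z s IHs /andP[zs Us] sA.
  rewrite IHs // ?andbT; last by move=> w ws; apply: sA; rewrite inE ws orbT.
  apply/allP => w ws /=; apply: fd; rewrite ?sA ?inE ?eqxx ?ws ?orbT //.
  by apply: contraNneq zs => ->.
Qed.

End Packings.

Section Count.
Variables (T : finType) (l : nat) (E : {set T * T}).
Hypotheses (l3 : 2 < l) (Es : dsym E) (Ei : dirr E).
Variable h : {set T * T}.
Hypothesis (hh : subcubic l E h).

Let hs : dsym h. Proof. by case: hh. Qed.
Let hE : h \subset E. Proof. by case: hh. Qed.
Let h23 : {in verts h, forall x, (deg h x == 2) || (deg h x == 3)}. Proof. by case: hh. Qed.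
Let hl c : long_cycle (drel h) 3 c -> l <= size c. Proof. by case: hh => _ _ _; apply. Qed.
Let hi : dirr h. Proof. by move=> x; apply: contra (Ei x); apply: (subsetP hE). Qed.

Lemma packing_sub k : packing (drel h) 3 k -> packing (drel E) l k.
Proof.
move=> [cs [Scs ccs pcs]]; exists cs; split=> // c /ccs hc; have [Uc cc _] := hc.
by split=> //; [apply: cycle_subset hE cc | apply: hl].
Qed.

Definition comp z := [set x | connect (drel (deg2 h)) z x].
Definition out z := [set d in h | (d.1 \in comp z) && (deg h d.2 == 3)].

Lemma deg2_sym : dsym (deg2 h).
Proof. by move=> x y; rewrite !inE /= => /and3P[/hs-> -> ->]. Qed.

Lemma deg2_connect_sym : connect_sym (drel (deg2 h)).
Proof. exact/sym_connect_sym/drel_sym/deg2_sym. Qed.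

Lemma comp_deg z x : deg h z = 2 -> x \in comp z -> deg h x = 2.
Proof.
rewrite inE => dz /connectP[p hp ->]; elim: p z dz hp => [|y p IHp] z dz //=.
by move=> /andP[]; rewrite {1}/drel inE /= => /and3P[_ _ /eqP dy]; apply: IHp.
Qed.

Lemma comp_next z x y : deg h z = 2 -> x \in comp z -> (x, y) \in h ->
  (y \in comp z) || (deg h y == 3).
Proof.
move=> dz xz xy; have dx := comp_deg dz xz.
case/orP: (h23 (vertsr hs xy)) => [dy|->]; last by rewrite orbT.
move: xz; rewrite !inE => /connect_trans->//; apply: connect1.
by rewrite /drel inE xy /= dx dy.
Qed.

(** Each vertex of the component has two darts, and each of these stays inside or enters a branch
    vertex. *)
Lemma comp_card z : deg h z = 2 -> 2 * #|comp z| = #|darts (comp z) h| + #|out z|.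
Proof.
move=> dz; have <- : #|darts (comp z) h :|: out z| = #|darts (comp z) h| + #|out z|.
  rewrite cardsU (_ : _ :&: _ = set0) ?cards0 ?subn0 //; apply/setP => -[x y]; rewrite !inE /=.
  apply/negP => /andP[/and3P[_ _ cy] /and3P[_ _ /eqP dy]].
  by have := comp_deg dz (x := y); rewrite inE dy => /(_ cy).
rewrite card_darts mulnC -sum_nat_const [LHS]big_mkcond; apply: eq_bigr => x _ /=.
case: ifP => xz; last by apply/esym/eq_card0 => y; move: xz; rewrite !inE /= => ->; rewrite !andbF.
rewrite -(comp_deg dz xz); apply: eq_card => y; have := comp_next dz xz (y := y); move: xz.
by rewrite !inE /= => -> /=; case: ((x, y) \in h) => //= /(_ isT).
Qed.

(** Parity: the darts inside the component come in opposite pairs, so by [comp_card] the number of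
    outgoing ones is even. *)
Lemma out_ge2 z : deg h z = 2 -> out z != set0 -> 2 <= #|out z|.
Proof.
move=> dz; rewrite -card_gt0; have := comp_card dz.
have ev : ~~ odd #|darts (comp z) h|.
  apply: sym_card_even => [x y|x]; last by rewrite !inE (negbTE (hi x)).
  by rewrite !inE /= => /and3P[/hs-> -> ->].
move=> E2; have : ~~ odd #|out z|.
  have : odd (2 * #|comp z|) = false by rewrite oddM.
  by rewrite E2 oddD (negbTE ev) /= => ->.
by case: #|out z| => [|[]].
Qed.

(** The component is then 2-regular, and [short_cycle] with [i = 0] finds a cycle in it, because
    [0 < 2 * 2 ^ 0]. *)
Lemma comp_cycle z : deg h z = 2 -> out z = set0 ->
  exists c, long_cycle (drel E) l c /\ {subset c <= comp z}.
Proof.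
move=> dz oz; pose g := darts (comp z) h.
have gh : g \subset h by apply/subsetP => d; rewrite inE => /andP[].
have gs : dsym g by move=> x y; rewrite !inE /= => /and3P[/hs-> -> ->].
have gi : dirr g by move=> x; apply: contra (hi x); apply: (subsetP gh).
have degg x : x \in comp z -> deg g x = 2.
  move=> xz; rewrite -(comp_deg dz xz); apply: eq_card => y; rewrite !inE /=.
  case xy: ((x, y) \in h) => //=; move: (xz); rewrite inE => -> /=.
  case/orP: (comp_next dz xz xy) => [|dy]; first by rewrite inE.
  by have : (x, y) \in out z; [rewrite inE xy /= xz | rewrite oz inE].
have gv x : x \in verts g -> x \in comp z.
  by move=> /vertsP[y]; rewrite inE => /and3P[].
have g23 : {in verts g, forall x, (deg g x == 2) || (deg g x == 3)}.
  by move=> x /gv/degg->.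
have b0 : branch g = set0.
  apply/setP => x; rewrite !inE; apply/negP => /eqP dx.
  by have := dx; rewrite degg //; apply: gv; rewrite inE dx.
have zz : z \in comp z by rewrite inE connect0.
have [|c [[Uc cc c3] _ _]] := @short_cycle _ g z gs gi g23 0.
  by rewrite b0 cards0 degg.
exists c; split; last by move=> x xc; apply: gv; apply: cycle_verts cc _ xc.
have hc := cycle_subset gh cc; split=> //; first exact: cycle_subset hE hc.
by apply: hl.
Qed.

Definition rep (A : {set T}) y := odflt y [pick w in A | connect (drel (deg2 h)) y w].

Lemma repP (A : {set T}) y : y \in A -> rep A y \in A /\ connect (drel (deg2 h)) y (rep A y).
Proof.
rewrite /rep; case: pickP => [w /andP[]//|/(_ y)]; rewrite connect0 andbT => H yA.
by rewrite yA in H.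
Qed.

Lemma rep_eq (A : {set T}) y y' : y \in A -> y' \in A -> connect (drel (deg2 h)) y y' -> rep A y = rep A y'.
Proof.
move=> yA y'A yy'; rewrite /rep (eq_pick (Q := fun w => (w \in A) && connect (drel (deg2 h)) y' w)).
  by case: pickP => // /(_ y'); rewrite y'A connect0.
by move=> w; congr (_ && _); apply: same_connect; [exact: deg2_connect_sym | ].
Qed.

(** One representative per component. Components without outgoing darts contain disjoint long
    cycles, so there are at most [k]; each other one has at least two of the [3 * #|branch h|] darts
    into branch vertices. *)
Lemma comp_transversal (A : {set T}) k : ~ packing (drel E) l k.+1 ->
  {in A, forall y, deg h y = 2} ->
  exists Z : {set T}, [/\ Z \subset A, {in A, forall y, exists2 z, z \in Z & connect (drel (deg2 h)) y z} &
    2 * #|Z| <= 3 * #|branch h| + 2 * k].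
Proof.
move=> np A2; pose Z := [set rep A y | y in A].
have ZA z : z \in Z -> z \in A by move=> /imsetP[y yA ->]; have [] := repP yA.
have Zd z z' : z \in Z -> z' \in Z -> connect (drel (deg2 h)) z z' -> z = z'.
  move=> /imsetP[y yA ->] /imsetP[y' y'A ->] c; have [rA cy] := repP yA; have [rA' cy'] := repP y'A.
  apply: rep_eq => //; apply: connect_trans cy _; apply: connect_trans c _.
  by rewrite deg2_connect_sym.
exists Z; split; first by apply/subsetP.
  by move=> y yA; exists (rep A y); [apply: imset_f | have [] := repP yA].
pose Z0 := [set z in Z | out z == set0]; pose Z1 := [set z in Z | out z != set0].
have -> : #|Z| = #|Z0| + #|Z1|.
  by rewrite -cardsUI (_ : Z0 :&: Z1 = set0) ?cards0 ?addn0;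
    [apply: eq_card | apply/setP] => z; rewrite !inE; case: (z \in Z); case: (out z == set0).
have Zin z : z \in Z0 \/ z \in Z1 -> z \in Z by rewrite !inE => -[]/andP[].
have z0k : #|Z0| <= k.
  rewrite leqNgt; apply/negP => kz; apply: np.
  have /choice[f Hf] : forall z, exists c, z \in Z0 -> long_cycle (drel E) l c /\ {subset c <= comp z}.
    move=> z; case: (boolP (z \in Z0)) => [|_]; last by exists [::].
    rewrite inE => /andP[zZ /eqP oz]; have [c Hc] := comp_cycle (A2 _ (ZA _ zZ)) oz.
    by exists c.
  apply: (packing_set (f := f) kz) => [z /Hf[]//|z z' zZ z'Z zz'].
  apply/pred0P => x /=; apply/negP => /andP[xz xz']; case/eqP: zz'.
  have [_ /(_ _ xz)] := Hf _ zZ; have [_ /(_ _ xz')] := Hf _ z'Z; rewrite !inE => c' c.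
  apply: Zd; [by apply: Zin; left | by apply: Zin; left | ].
  by apply: connect_trans c _; rewrite deg2_connect_sym.
have z1u : 2 * #|Z1| <= 3 * #|branch h|.
  apply: (@leq_trans (\sum_(z in Z1) #|out z|)).
    rewrite mulnC -sum_nat_const; apply: leq_sum => z; rewrite inE => /andP[zZ oz].
    exact: out_ge2 (A2 _ (ZA _ zZ)) oz.
  pose D := [set d in h | deg h d.2 == 3].
  apply: (@leq_trans #|D|).
    (* Counting dart by dart: the component of its start determines [z], so a dart belongs to
       [out z] for at most one [z] in [Z1]. *)
    under eq_bigr => z _ do rewrite -sum1_card big_mkcond /=.
    rewrite exchange_big /= -sum1_card [leqRHS]big_mkcond /=; apply: leq_sum => d _.
    case: (boolP (d \in D)) => dD; last first.
      rewrite big1 // => z _; case: ifP => //; rewrite inE => /and3P[dh _ d3].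
      by case/negP: dD; rewrite inE dh.
    case: (pickP (fun z => (z \in Z1) && (d \in out z))) => [z /andP[zZ dz]|no]; last first.
      by rewrite big1 // => z zZ; have := no z; rewrite zZ /= => ->.
    rewrite (bigD1 z) //= dz big1 // => z' /andP[z'Z zz']; case: ifP => // dz'.
    case/eqP: zz'; apply: Zd; [by apply: Zin; right | by apply: Zin; right | ].
    move: dz dz'; rewrite !inE => /and3P[_ c _] /and3P[_ c' _].
    by apply: connect_trans c' _; rewrite deg2_connect_sym.
  have swap_inj : injective (fun d : T * T => (d.2, d.1)) by move=> [? ?] [? ?] [-> ->].
  rewrite -(card_imset D swap_inj) card_darts mulnC -sum_nat_const [leqRHS]big_mkcond /=.
  apply: leq_sum => x _; case: ifP => [|nb].
    rewrite inE => /eqP <-; apply: subset_leq_card; apply/subsetP => y; rewrite !inE.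
    by move=> /imsetP[[u v]]; rewrite inE /= => /andP[/hs uv _] [-> ->].
  rewrite leqn0; apply/eqP/eq_card0 => y; rewrite !inE; apply/negP => /imsetP[[u v]].
  by rewrite inE /= => /andP[_ d3] [E1 _]; rewrite inE E1 d3 in nb.
by move: z0k z1u; clear; lia.
Qed.

End Count.

(** With [b] branch vertices, the three parts of [X] give [2 * b + (3 * b + 2 * k) + 2 * k], and
    [b <= k * (4 * i + 4) + 1] by [excess_packing]. *)
Lemma gap_hitting_set (T : finType) (l k i : nat) (E : {set T * T}) :
  2 < l -> dsym E -> dirr E -> (forall c, long_cycle (drel E) l c -> 6 * l < size c) ->
  ~ packing (drel E) l k.+1 -> k * (4 * i + 4) + 3 < 3 * 2 ^ i ->
  exists X : {set T}, 2 * #|X| <= 5 * (k * (4 * i + 4) + 1) + 4 * k /\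
    forall s, long_cycle (drel E) l s -> ~ [disjoint s & X].
Proof.
move=> l3 Es Ei gap np Ki; have [h hh hmax] := subcubic_max l E.
have [hs hE h23 hl] := hh.
have hi : dirr h by move=> x; apply: contra (Ei x); apply: (subsetP hE).
have bk : #|branch h| <= k * (4 * i + 4) + 1.
  rewrite leqNgt; apply/negP => big; apply: np; apply: (packing_sub hh).
  apply: (excess_packing Ki (leqnn k) hs hi) => [x|].
    case: (boolP (x \in verts h)) => [/h23/orP[]/eqP->//|xv].
    by rewrite deg0_notin.
  rewrite -addnA card_darts; have := sum_deg_branch h23 setT; rewrite !setTI => Esum.
  under [leqRHS]eq_bigl => x do rewrite -[true](in_setT x).
  by rewrite Esum leq_add2l; move: big; clear; lia.
pose A := [set y | `[< changing l E h y >]].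
have A2 : {in A, forall y, deg h y = 2} by move=> y; rewrite inE => /asboolP[].
have [Z [ZA HZ Zk]] := comp_transversal Ei hh np A2.
have HZ' y : changing l E h y -> exists z, [/\ z \in Z, changing l E h z & connect (drel (deg2 h)) y z].
  move=> cy; have yA : y \in A by rewrite inE; apply/asboolP.
  have [z zZ yz] := HZ _ yA; exists z; split=> //.
  by have := subsetP ZA _ zZ; rewrite inE => /asboolP.
pose W := [set v | `[< exists c, touching l E h v c >]].
have Wk : #|W| <= k.
  rewrite leqNgt; apply/negP => kW; apply: np.
  have /choice[f Hf] : forall v, exists c, v \in W -> touching l E h v c.
    move=> v; case: (boolP (v \in W)) => [|_]; last by exists [::].
    by rewrite inE => /asboolP[c Hc]; exists c.
  apply: (packing_set (f := f) kW) => [v /Hf[]//|v v' vW v'W vv'].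
  exact (touching_disjoint Es gap hh hmax (Hf _ vW) (Hf _ v'W) vv').
exists (branch h :|: Z :|: W); split.
  have := leq_trans (leq_card_setU (branch h :|: Z) W) (leq_add (leq_card_setU _ _) (leqnn _)).
  by move: bk Zk Wk; move: (k * _); clear; lia.
move=> s ls ds; have out x : x \in s -> [/\ x \notin branch h, x \notin Z & x \notin W].
  by move=> xs; have := disjointFr ds xs; rewrite !in_setU => /negbT; rewrite !negb_or => /andP[/andP[]].
have [u us uV] := long_meets l3 Es hh hmax ls.
apply: (no_long_cycle l3 Es Ei gap hh hmax HZ' ls) => [x /out[]//|x /out[]//|].
(* A cycle that meets [h] only in [u] would put [u] into [W]. *)
apply: contrapT => one; have [ub _ /negP] := out _ us; rewrite inE; apply; apply/asboolP.
exists s; split=> //; first by move: ub; rewrite inE; case/orP: (h23 _ uV) => /eqP->.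
move=> z zs zV; apply: contrapT => /eqP zu; apply: one; exists z, u; by split.
Qed.

From Stdlib Require Import Reals Lra.

(** * Comparison with the bound *)

Section Numeric.
Local Open Scope R_scope.

Lemma ln2_pos : 0 < ln 2.
Proof. rewrite -ln_1; apply: ln_increasing; lra. Qed.

Lemma log2_le x y : 0 < x -> x <= y -> log2 x <= log2 y.
Proof.
move=> x0 xy; apply: Rmult_le_compat_r; first by apply/Rlt_le/Rinv_0_lt_compat/ln2_pos.
case: (Rle_lt_or_eq_dec _ _ xy) => [lt|->]; last exact: Rle_refl.
exact/Rlt_le/ln_increasing.
Qed.

Lemma log2_2 : log2 2 = 1.
Proof. rewrite /log2; field; have := ln2_pos; lra. Qed.

Lemma log2_1 : log2 1 = 0.
Proof. by rewrite /log2 ln_1 /Rdiv Rmult_0_l. Qed.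

Lemma leq_INR (m n : nat) : (m <= n)%nat -> INR m <= INR n.
Proof. by move=> mn; apply: le_INR; apply/leP. Qed.

Lemma INR_ge2 (n : nat) : (2 <= n)%nat -> 2 <= INR n.
Proof. by move=> n2; have := leq_INR n2; rewrite [INR 2]/=; lra. Qed.

Lemma log2_ge1 (n : nat) : (2 <= n)%nat -> 1 <= log2 (INR n).
Proof. by move=> n2; rewrite -log2_2; apply: log2_le; [lra | apply: INR_ge2]. Qed.

Lemma loglog_ge0 (n : nat) : (2 <= n)%nat -> 0 <= log2 (log2 (INR n)).
Proof. by move=> n2; rewrite -log2_1; apply: log2_le; [lra | apply: log2_ge1]. Qed.

(** The increment pays for deleting a long cycle with at most [6 * l] vertices. The case [k = 1] is
    separate, as the bound is 0 there by definition. *)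
Lemma fbound_step (l k : nat) : (1 <= k)%nat ->
  fbound l k + 6 * INR l <= fbound l k.+1.
Proof.
move=> k1; rewrite /fbound (_ : (2 <= k.+1)%nat) //; have l0 := pos_INR l.
have K2 : (2 <= k.+1)%nat by [].
have L1 := log2_ge1 K2; have M0 := loglog_ge0 K2; have n2 := INR_ge2 K2.
case: ifP => k2; last first.
  have : INR k.+1 * INR l >= 2 * INR l by apply: Rle_ge; apply: Rmult_le_compat_r.
  have : 0 <= INR k.+1 * log2 (INR k.+1) by apply: Rmult_le_pos; lra.
  have : 0 <= INR k.+1 * log2 (log2 (INR k.+1)) by apply: Rmult_le_pos; lra.
  by nra.
have k2' := INR_ge2 k2; have L1' := log2_ge1 k2; have M0' := loglog_ge0 k2.
have kk : INR k.+1 = INR k + 1 by rewrite S_INR.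
have LL : log2 (INR k) <= log2 (INR k.+1) by apply: log2_le; lra.
have MM : log2 (log2 (INR k)) <= log2 (log2 (INR k.+1)) by apply: log2_le; lra.
move: LL MM L1 M0; rewrite kk; move: (log2 (INR k)) (log2 (INR k + 1)) L1' => a b.
move: (log2 a) (log2 b) M0' => c d *.
have : INR k * a <= INR k * b by apply: Rmult_le_compat_l; lra.
have : INR k * c <= INR k * d by apply: Rmult_le_compat_l; lra.
by lra.
Qed.

Lemma ln_le_sub1 x : 0 < x -> ln x <= x - 1.
Proof. by move=> x0; have := exp_ineq1_le (ln x); rewrite exp_ln //; lra. Qed.

Lemma log2_le_id x : 0 < x -> log2 x <= x.
Proof.
move=> x0; have h2 := ln_lt_2; have l2 := ln_le_sub1 (_ : 0 < 2).
have : ln x <= x / 2.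
  have -> : ln x = ln (x / 2) + ln 2 by rewrite -ln_mult; [congr ln; field | lra | lra].
  have := ln_le_sub1 (_ : 0 < x / 2); lra.
move=> lx; apply: (Rmult_le_reg_r (ln 2)); first exact: ln2_pos.
have -> : log2 x * ln 2 = ln x by rewrite /log2; field; have := ln2_pos; lra.
nra.
Qed.

Lemma nat_floor x : 0 <= x -> exists n : nat, INR n <= x < INR n + 1.
Proof.
move=> x0; have [u1 u2] := archimed x; exists (Z.to_nat (up x - 1)).
have u0 : (0 < up x)%Z by apply: lt_IZR; lra.
rewrite INR_IZR_INZ Znat.Z2Nat.id; last by move: u0; clear; lia.
by rewrite minus_IZR; lra.
Qed.

Lemma INR_expn2 i : INR (expn 2 i) = 2 ^ i.
Proof. by elim: i => [|i IHi] //; rewrite expnS mult_INR IHi. Qed.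

Lemma expn2_ge (i : nat) y : 0 < y -> log2 y <= INR i -> y <= INR (expn 2 i).
Proof.
move=> y0 yi; rewrite INR_expn2; apply: Rnot_lt_le => lt.
have p0 : 0 < 2 ^ i by apply: pow_lt; lra.
have := ln_increasing _ _ p0 lt; rewrite ln_pow; last lra.
move: yi; rewrite /log2 => yi.
have : ln y / ln 2 * ln 2 <= INR i * ln 2 by apply: Rmult_le_compat_r => //; apply/Rlt_le/ln2_pos.
have -> : ln y / ln 2 * ln 2 = ln y by field; have := ln2_pos; lra.
lra.
Qed.

Lemma log2_mult x y : 0 < x -> 0 < y -> log2 (x * y) = log2 x + log2 y.
Proof. by move=> x0 y0; rewrite /log2 ln_mult //; field; have := ln2_pos; lra. Qed.

(** Because 10^2 = 100 is less than 128 = 2^7. *)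
Lemma log2_10 : log2 10 <= 7 / 2.
Proof.
have e100 : ln 100 = 2 * ln 10 by rewrite (_ : 100 = 10 ^ 2) ?ln_pow /=; lra.
have e128 : ln 128 = 7 * ln 2 by rewrite (_ : 128 = 2 ^ 7) ?ln_pow /=; lra.
have := ln_increasing 100 128 (_ : 0 < 100) (_ : 100 < 128).
have l2 := ln2_pos => H.
apply: (Rmult_le_reg_r (ln 2)) => //.
have -> : log2 10 * ln 2 = ln 10 by rewrite /log2; field; lra.
by have := H; lra.
Qed.

(* With [i + 1] the integer part of [log k + log log k + 5.5], [2 ^ i] exceeds
   [10 k log k], which beats the linear term. *)
Lemma branch_budget (l k : nat) : (3 <= l)%nat -> (1 <= k)%nat ->
  exists i, (k * (4 * i + 4) + 3 < 3 * expn 2 i)%nat /\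
    5 * (INR k * (4 * INR i + 4) + 1) + 4 * INR k <= 2 * fbound l k.+1.
Proof.
move=> l3 k1; have K2 : (2 <= k.+1)%nat by [].
rewrite /fbound K2.
have L1 := log2_ge1 K2; have M0 := loglog_ge0 K2; have n2 := INR_ge2 K2.
have l3' : 3 <= INR l by have := leq_INR l3; rewrite [INR 3]/=; lra.
have kk : INR k = INR k.+1 - 1 by rewrite S_INR; lra.
have lg : log2 (10 * (INR k.+1 * log2 (INR k.+1))) <= 7 / 2 + log2 (INR k.+1) + log2 (log2 (INR k.+1)).
  rewrite log2_mult; [|lra|nra]; rewrite log2_mult; [|lra|lra].
  by have := log2_10; lra.
have ML := log2_le_id (_ : 0 < log2 (INR k.+1)).
move: lg ML L1 M0 n2; set K := INR k.+1; set L := log2 K; set M := log2 L => lg ML L1 M0 n2.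
have {}ML : M <= L by apply: ML; lra.
(* The summand 11/2 is the bound 7/2 on [log2 10] plus 2: one for rounding down and one for
   [j = i + 1]. *)
have [j [j1 j2]] : exists n : nat, INR n <= L + M + 11 / 2 < INR n + 1 by apply: nat_floor; lra.
case: j j1 j2 => [|i] j1 j2; first by move: j2; rewrite [INR 0]/=; lra.
rewrite S_INR in j1 j2; exists i; have p10 : 10 * (K * L) <= INR (expn 2 i).
  by apply: expn2_ge; [nra | lra].
split.
  apply/leP/INR_lt.
  rewrite plus_INR !mult_INR plus_INR mult_INR kk -/K [INR 4]/= [INR 3]/=.
  move: p10; set P := INR (expn 2 i) => p10.
  have KL : K <= K * L by nra.
  have KM : K * M <= K * L by apply: Rmult_le_compat_l; lra.
  have Ki : (K - 1) * (INR i + 1) <= (K - 1) * (L + M + 11 / 2) by apply: Rmult_le_compat_l; lra.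
  (* The factor 10 balances here: from [M <= L] and [1 <= L], [4 * K * (L + M + 11 / 2) <= 30 * K *
     L = 3 * (10 * K * L)]. Having [K - 1] in place of [K] absorbs the summand 3. *)
  nra.
rewrite kk -/K.
(* The linear part needs [57 * (K - 1) + 5 / 2]; of this, [40 * K] is explicit in the bound and
   [18 * K] comes from [6 * K * l] with [l] at least 3. *)
have Kl : K * 3 <= K * INR l by apply: Rmult_le_compat_l; lra.
have Ki : (K - 1) * (INR i + 1) <= (K - 1) * (L + M + 11 / 2) by apply: Rmult_le_compat_l; lra.
nra.
Qed.

End Numeric.

(** * Induction on the number of cycles *)

Lemma packing_or_hitting_set (T : finType) (l k : nat) (E : {set T * T}) :
  2 < l -> dsym E -> dirr E ->
  packing (drel E) l k.+1 \/
  exists X : {set T}, (INR #|X| <= fbound l k.+1)%R /\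
    forall s, long_cycle (drel E) l s -> ~ [disjoint s & X].
Proof.
move=> l3; elim: k E => [|k IHk] E Es Ei.
  have [[c lc]|nc] := pselect (exists c, long_cycle (drel E) l c).
    by left; exists [:: c]; split=> // c'; rewrite inE => /eqP->.
  right; exists set0; rewrite cards0 /fbound /=; split; first exact: Rle_refl.
  by move=> s ls; case: nc; exists s.
have [|np] := pselect (packing (drel E) l k.+2); first by left.
right; have [[c [lc c6]]|gap] := pselect (exists c, long_cycle (drel E) l c /\ size c <= 6 * l).
  pose C := [set x in c]; pose E' := darts (~: C) E.
  have E'E : E' \subset E by apply/subsetP => d; rewrite inE => /andP[].
  have E's : dsym E' by move=> x y; rewrite !inE /= => /and3P[/Es-> -> ->].
  have E'i : dirr E' by move=> x; apply: contra (Ei x); apply: (subsetP E'E).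
  case: (IHk E' E's E'i) => [[cs [Scs ccs pcs]]|[X' [X'k HX']]].
    case: np; exists (c :: cs); split=> /=; first by rewrite Scs.
      move=> c'; rewrite inE => /orP[/eqP->//|/ccs[Uc' cc' lc']].
      by split=> //; apply: cycle_subset E'E cc'.
    rewrite pcs andbT; apply/allP => c' /ccs[_ cc' _].
    apply/pred0P => x /=; apply/negP => /andP[xc /(cycle_verts E's cc')/vertsP[y]].
    by rewrite !inE /= xc andbF.
  exists (X' :|: C); split.
    have Ck : #|C| <= 6 * l by rewrite cardsE; apply: leq_trans (card_size c) c6.
    have := leq_INR (leq_trans (leq_card_setU X' C) (leq_add (leqnn _) Ck)).
    rewrite plus_INR mult_INR [INR 6]/=; have := fbound_step l (ltn0Sn k); lra.
  move=> s ls ds; have [Us cs szs] := ls.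
  have [dX dC] : [disjoint s & X'] /\ [disjoint s & C].
    by split; apply: disjointWr ds; rewrite ?subsetUl ?subsetUr.
  apply: (HX' s) => //; split=> //.
  apply: (@sub_in_cycle _ (mem s) (drel E)) cs; last by apply/allP.
  move=> x y xs ys; rewrite /drel !inE /= => ->.
  by have := disjointFr dC xs; have := disjointFr dC ys; rewrite !inE => -> ->.
have gap' c : long_cycle (drel E) l c -> 6 * l < size c.
  by move=> lc; rewrite ltnNge; apply/negP => c6; apply: gap; exists c.
have [i [Ki bud]] := branch_budget l3 (ltn0Sn k).
have [X [X2 HX]] := gap_hitting_set l3 Es Ei gap' np Ki.
exists X; split=> //; have := leq_INR X2.
have -> : INR (2 * #|X|) = (2 * INR #|X|)%R by rewrite mult_INR.
have -> : INR (5 * (k.+1 * (4 * i + 4) + 1) + 4 * k.+1) =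
    (5 * (INR k.+1 * (4 * INR i + 4) + 1) + 4 * INR k.+1)%R.
  rewrite plus_INR 2!mult_INR plus_INR mult_INR plus_INR mult_INR.
  rewrite [INR 5]/= [INR 4]/= [INR 1]/=; lra.
by move: bud; lra.
Qed.

Theorem theorem1 (l k : nat) (T : finType) (e : rel T) :
  (3 <= l)%N -> (1 <= k)%N -> simple_graph e ->
  (exists c : 'I_k -> seq T,
      (forall i, long_cycle e l (c i)) /\
      (forall i j, i != j -> [disjoint c i & c j]))
  \/
  (exists X : {set T},
      (INR #|X| <= fbound l k)%R /\
      (forall s : seq T, ~ long_cycle_avoiding e l X s)).
Proof.
case: k => // k l3 _ [es ei].
pose E : {set T * T} := [set d | e d.1 d.2].
have Ee : drel E =2 e by move=> x y; rewrite /drel inE.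
have lE s : long_cycle e l s <-> long_cycle (drel E) l s.
  by rewrite /long_cycle (eq_cycle Ee).
have Es : dsym E by move=> x y; rewrite !inE /= es.
have Ei : dirr E by move=> x; rewrite inE /= ei.
have [[cs [Scs ccs pcs]]|[X [Xk HX]]] := packing_or_hitting_set k l3 Es Ei; [left | right].
  have lt (i : 'I_k.+1) : i < size cs by rewrite Scs.
  exists (fun i => nth [::] cs i); split=> [i|i j]; first by apply/lE/ccs/mem_nth.
  wlog lij : i j / i < j => [H|_].
    have [ij|ji|/val_inj->] := ltngtP i j; [exact: H | | by rewrite eqxx].
    by rewrite eq_sym disjoint_sym; apply: H.
  by have /pairwiseP := pcs; apply; rewrite ?inE.
by exists X; split=> // s [/lE ls]; apply: HX.
Qed.
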